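(* Let $\omega\in\mathbb{C}$ satisfy $\omega^2+\omega+1=0$, and put $$\varphi_1(x)=\frac{x\,(x-1)\,\left(27x^2-(723+1392\omega)x-496+696\omega\right)^3}{64\,\big((6\omega+3)x-8-3\omega\big)^7}.$$ Then $\varphi_1:\mathbb{P}^1\to\mathbb{P}^1$ is a covering of degree $8$ which defines a pull-back transformation from a hypergeometric equation with local exponent differences $(1/2,1/3,1/7)$ (in some order at the singular points) to a hypergeometric equation with local exponent differences $(1/3,1/3,1/7)$ (in some order). Moreover, in a neighborhood of $x=0$ the following identities hold: $${}_2F_1\!\left(\tfrac{2}{21},\tfrac{5}{21};\tfrac23;x\right)=\left(1-\tfrac{33+39\omega}{49}\,x\right)^{-1/12}{}_2F_1\!\left(\tfrac1{84},\tfrac{13}{84};\tfrac23;\varphi_1(x)\right),$$ $${}_2F_1\!\left(\tfrac{2}{21},\tfrac{3}{7};\tfrac67;x\right)=(1-x)^{-1/84}\left(1-\tfrac{241+464\omega}{9}\,x-\tfrac{8(62-87\omega)}{27}\,x^2\right)^{-1/28}{}_2F_1\!\left(\tfrac1{84},\tfrac{29}{84};\tfrac67;\tfrac{1}{\varphi_1(1/x)}\right).$$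
   Context: ${}_2F_1(A,B;C;z)$ is the Gauss hypergeometric function, a solution of the hypergeometric equation $z(1-z)y''+(C-(A+B+1)z)y'-AB\,y=0$, whose local exponent differences at $z=0,1,\infty$ are (up to sign) $1-C$, $C-A-B$, $A-B$. A pull-back transformation is $z\mapsto\varphi(x)$, $y(z)\mapsto Y(x)=\theta(x)y(\varphi(x))$ with $\varphi$ a rational function and $\theta$ a product of powers of rational functions; it is said to be defined by the covering $\varphi$ (with suitable $\theta$), and it transforms the equation for $y$ into the equation for $Y$. The identities are between analytic functions near $x=0$; fractional powers of functions with value $1$ at $x=0$ denote the branch with value $1$ at $x=0$. *)

(* Defs.v *)
From HB Require Import structures.
From mathcomp Require Import all_boot all_order all_algebra.
From mathcomp Require Import complex.
From mathcomp Require Import all_classical all_reals all_analysis.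

Set Implicit Arguments.
Unset Strict Implicit.
Unset Printing Implicit Defensive.

Import Order.TTheory GRing.Theory Num.Theory numFieldNormedType.Exports.

Local Open Scope complex_scope.
Local Open Scope ring_scope.
Local Open Scope classical_set_scope.

(* The complex numbers, as an abstract numFieldType: its topology is then the one
   MathComp-Analysis attaches to the norm of any numFieldType, and derivable and
   derive1 are complex differentiation. *)
Definition Cplx (R : realType) : numFieldType := R[i].

Section Hypergeometric.
Variable C : numFieldType.
Implicit Types (a b c z : C) (y : C -> C).

(* (a)_n = a (a + 1) ... (a + n - 1) *)
Definition pochhammer a (n : nat) : C := \prod_(k < n) (a + k%:R).

(* 2F1(a, b; c; z); meaningful for `|z| < 1 and c not in {0, -1, -2, ...}. *)
Definition hyp2F1 a b c z : C :=
  limn (series (fun n : nat =>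
    pochhammer a n * pochhammer b n / (pochhammer c n * n`!%:R) * z ^+ n)).

(* y is a solution, in a neighbourhood of z0, of the hypergeometric equation
   E(a, b, c). *)
Definition hyp_solution a b c y (z0 : C) : Prop :=
  let y1 : C -> C := derive1 y in
  let y2 : C -> C := derive1 y1 in
  \forall z \near z0,
    [/\ derivable y z 1, derivable y1 z 1 &
        z * (1 - z) * y2 z + (c - (a + b + 1) * z) * y1 z - a * b * y z = 0].

(* The local exponent differences of E(a, b, c) at 0, 1 and infinity, in some
   order and up to sign, are e. *)
Definition exponent_differences a b c (e : seq C) : Prop :=
  exists2 e' : seq C, perm_eq e' e &
    all2 (fun u v => (u == v) || (u == - v)) [:: 1 - c; c - a - b; a - b] e'.

End Hypergeometric.

Section RationalFunctions.
Variable C : numFieldType.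
Implicit Types p q : {poly C}.

Definition ratfun p q (x : C) : C := p.[x] / q.[x].

(* The projective line is option C, with None as the point at infinity.  If
   d = max (deg p) (deg q), then [p : q] = [local_form d p t : local_form d q t]
   in terms of the local parameter at t, which is x - a at t = Some a and 1 / x
   at t = None (after multiplication of both entries by x ^ -d). *)
Definition local_form (d : nat) p (t : option C) : {poly C} :=
  if t is Some a then p \Po ('X + a%:P) else \poly_(i < d.+1) p`_(d - i).

Definition ratdeg p q : nat := (maxn (size p) (size q)).-1.

(* The next two definitions are meaningful for coprime p and q, in which case
   the two local forms do not both vanish at 0. *)
Definition P1map p q (t : option C) : option C :=
  let u := (local_form (ratdeg p q) p t).[0] in
  let v := (local_form (ratdeg p q) q t).[0] in
  if v == 0 then None else Some (u / v).

(* The multiplicity with which p / q takes the value P1map p q t at t, that is,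
   the ramification index at t. *)
Definition ramification p q (t : option C) : nat :=
  let P := local_form (ratdeg p q) p t in
  let Q := local_form (ratdeg p q) q t in
  mup 0 (Q.[0] *: P - P.[0] *: Q).

(* p / q, in lowest terms, defines a (branched) covering P^1 -> P^1 of degree d:
   every fibre is finite and has d points, counted with multiplicity. *)
Definition covering_of_degree p q (d : nat) : Prop :=
  coprimep p q /\
  forall w : option C, exists s : seq (option C),
    [/\ uniq s, (forall t, (t \in s) = (P1map p q t == w)) &
        (\sum_(t <- s) ramification p q t)%N = d].

End RationalFunctions.

Section Branches.
Variable R : realType.
Local Notation C := (Cplx R).
Implicit Types (f g L : C -> C) (x : C).

Definition cexp (z : C) : C :=
  let: u +i* v := (z : R[i]) in (expR u * cos v) +i* (expR u * sin v).

Definition log_branch f L (x0 : C) : Prop :=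
  \forall x \near x0, derivable L x 1 /\ cexp (L x) = f x.

(* g is, near x0, a branch of the possibly multivalued function f^e.  Two such
   branches differ near x0 by a constant factor, so that the branch is
   determined by its value at x0. *)
Definition pow_branch f (e : C) g (x0 : C) : Prop :=
  exists2 L, log_branch f L x0 & \forall x \near x0, g x = cexp (e * L x).

End Branches.

Section PullBack.
Variable R : realType.
Local Notation C := (Cplx R).
Implicit Types p q : {poly C}.

(* theta is, near x0, a branch of the product of the (r i / s i) ^ (e i). *)
Definition pow_product_branch (m : nat) (r s : 'I_m -> {poly C}) (e : 'I_m -> C)
    (theta : C -> C) (x0 : C) : Prop :=
  exists2 g : 'I_m -> C -> C,
    forall i, pow_branch (ratfun (r i) (s i)) (e i) (g i) x0 &
    \forall x \near x0, theta x = \prod_(i < m) g i x.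

(* For a suitable theta, y(z) |-> theta(x) y(p(x)/q(x)) transforms E(a, b, c)
   into E(a', b', c').  Solutions are compared at the points x0 such that
   neither x0 nor p(x0)/q(x0) is one of the singular points 0, 1, infinity. *)
Definition defines_pullback p q (a b c a' b' c' : C) : Prop :=
  exists (m : nat) (r s : 'I_m -> {poly C}) (e : 'I_m -> C),
    (forall i, r i != 0 /\ s i != 0) /\
    forall (x0 : C) (y theta : C -> C),
      x0 != 0 -> x0 != 1 ->
      q.[x0] != 0 -> ratfun p q x0 != 0 -> ratfun p q x0 != 1 ->
      hyp_solution a b c y (ratfun p q x0) ->
      pow_product_branch r s e theta x0 ->
      hyp_solution a' b' c' (fun x => theta x * y (ratfun p q x)) x0.

End PullBack.

Section Phi1.
Variable C : numFieldType.
Implicit Types omega x : C.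

Definition phi1_num omega : {poly C} :=
  'X * ('X - 1) *
  (27 *: 'X^2 - (723 + 1392 * omega) *: 'X + (- 496 + 696 * omega)%:P) ^+ 3.

Definition phi1_den omega : {poly C} :=
  64 *: ((6 * omega + 3) *: 'X + (- 8 - 3 * omega)%:P) ^+ 7.

(* As 0^-1 = 0, the expression 1 / phi1 omega (1 / x) takes at x = 0 the value
   0, which is also its limit there, phi1 having a simple pole at infinity. *)
Definition phi1 omega : C -> C := ratfun (phi1_num omega) (phi1_den omega).

End Phi1.

(* Main.v *)
Require Import Defs.
From HB Require Import structures.
From mathcomp Require Import all_boot all_order all_algebra.
From mathcomp Require Import complex.
From mathcomp Require Import all_classical all_reals all_analysis.
From mathcomp Require Import ring lra zify.

Set Implicit Arguments.
Unset Strict Implicit.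
Unset Printing Implicit Defensive.

Import Order.TTheory GRing.Theory Num.Theory numFieldNormedType.Exports.

Local Open Scope complex_scope.
Local Open Scope ring_scope.
Local Open Scope classical_set_scope.

(* Both sides of each identity solve the same hypergeometric equation near 0 and
   agree at 0.  For the right-hand sides this is a chain-rule computation: with
   L and Q the linear and quadratic factors of phi1, the numerator of 1 - phi1
   is a perfect square S ^ 2, phi1' is a constant times Q ^ 2 S / L ^ 8, and the
   pulled-back equation becomes three polynomial identities over Q(omega).  The
   same computation with x replaced by 1 / x gives the second identity.

   A solution y near 0 with y(0) = 0 vanishes when c is real and c >= 1/4: put
   p = y' and q = y / z; then z p' = - c p + O(z)(|p| + |q|) and z q' = p - q, so
   that F = |p| ^ 2 + |q| ^ 2 satisfies t F' <= O(t) F on every ray, and F tends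
   to 0 at the origin.  This replaces analyticity, since only the existence of
   two complex derivatives is used. *)

(** The exponents of theta are dictated by ramification. [phi1] has triple points over 0 at the
    zeros of Q and double points over 1 at the zeros of S; against the exponent differences 1/3 and
    1/2 these become ordinary points. At the zero of L the pole has order 7, so the exponents 1/84
    and 13/84 at infinity become 1/12 and 13/12, and the factor L ^ (-1/12) shifts them to 0 and 1.
    Only 0, 1 and infinity, where [phi1] is unramified, stay singular. For 1 / phi1 (1 / x) the
    poles are 1, of order 1, and the zeros of the reversed Q, of order 3; hence the exponents -1/84
    and -3/84 = -1/28. Theta enters the equation only through theta' / theta, which is rational, so
    the choice of a branch matters only for the value at 0. Uniqueness is delicate because 0 is a
    singular point: the initial value problem there is not a regular one, and a second local
    solution behaves like z ^ (1 - c) with 0 < 1 - c < 1. It is excluded because its derivative is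
    unbounded, whereas [hyp_solution] makes y' differentiable, hence continuous, at 0. *)

Section Calculus.
Variable C : numFieldType.
Implicit Types (f g : C -> C) (x df dg : C).

Lemma is_derive_chain f g x df dg :
  is_derive x 1 g dg -> is_derive (g x) 1 f df ->
  is_derive x 1 (fun z => f (g z)) (df * dg).
Proof.
move=> [/derivable1_diffP gx gE] [/derivable1_diffP fx fE].
have fgx : differentiable (f \o g) x by exact: differentiable_comp.
apply: DeriveDef; first exact/derivable1_diffP.
rewrite -derive1E derive1E'// diff_comp//= -[X in 'd _ _ X]mulr1.
rewrite -/(_ *: (1 : C)) linearZ /= mulrC.
by congr (_ * _); rewrite -derive1E' // derive1E.
Qed.

Lemma is_derive1D f g x df dg : is_derive x 1 f df -> is_derive x 1 g dg ->
  is_derive x 1 (fun z => f z + g z) (df + dg).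
Proof. by move=> *; apply: is_deriveD. Qed.

Lemma is_derive1B f g x df dg : is_derive x 1 f df -> is_derive x 1 g dg ->
  is_derive x 1 (fun z => f z - g z) (df - dg).
Proof. by move=> *; apply: is_deriveB. Qed.

Lemma is_derive1M f g x df dg : is_derive x 1 f df -> is_derive x 1 g dg ->
  is_derive x 1 (fun z => f z * g z) (df * g x + f x * dg).
Proof.
by move=> *; apply: (is_derive_eq (is_deriveM _ _)); rewrite /GRing.scale/=; ring.
Qed.

Lemma is_derive1_cst (k x : C) : is_derive x 1 (fun=> k) 0.
Proof. exact: is_derive_cst. Qed.

Lemma is_derive1_id x : is_derive x 1 (fun z => z) 1.
Proof. exact: is_derive_id. Qed.

Lemma is_derive1Z (k x df : C) f : is_derive x 1 f df ->
  is_derive x 1 (fun z => k * f z) (k * df).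
Proof. by move=> *; apply: (is_deriveZ). Qed.

Lemma is_derive1X f x df n : is_derive x 1 f df ->
  is_derive x 1 (fun z => f z ^+ n.+1) (n.+1%:R * f x ^+ n * df).
Proof.
move=> fx; elim: n => [|n IHn]; first by rewrite mul1r expr0 mul1r.
rewrite (_ : (fun _ => _) = (fun z => f z * f z ^+ n.+1)); last first.
  by apply/funext => z; rewrite exprS.
apply: is_derive_eq (is_derive1M fx IHn) _.
by rewrite -(natr1 n.+1) !exprS; ring.
Qed.

Lemma is_derive1V f x df : f x != 0 -> is_derive x 1 f df ->
  is_derive x 1 (fun z => (f z)^-1) (- df / f x ^+ 2).
Proof.
move=> fx0 [fx fE]; apply: DeriveDef; first exact: derivableV.
rewrite deriveV// fE /GRing.scale/=; ring.
Qed.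

Lemma is_derive1_continuous f x df : is_derive x 1 f df -> {for x, continuous f}.
Proof. by move=> [/derivable1_diffP/differentiable_continuous]. Qed.

Lemma derive1_is_derive f x df : is_derive x 1 f df -> derive1 f x = df.
Proof. by move=> [_ <-]; rewrite derive1E. Qed.

Lemma is_deriveP f x df : is_derive x 1 f df <->
  forall e : C, 0 < e -> \forall h \near 0, `|f (x + h) - f x - h * df| <= e * `|h|.
Proof.
split=> [[fx <-] e e0|H].
  have /eqaddoP := derivable_nbhs fx.
  move=> /(_ e e0); apply: filterS => h /=.
  rewrite !fctE /=; congr (`|_| <= _).
  by rewrite [_%:A]mulr1 opprD addrA (addrC h).
have lim : (fun h => h^-1 *: ((f \o shift x) (h *: 1) - f x)) @ 0^' --> df.
  apply/cvgrPdist_le => e e0; 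
  rewrite near_withinE; apply: filterS (H e e0) => h /= He h0.
  rewrite [_ *: 1]mulr1 distrC [_ *: _]mulrC (addrC h).
  rewrite -(ler_pM2r (_ : 0 < `|h|)) ?normr_gt0// -normrM.
  by rewrite mulrBl -mulrA mulVf// mulr1 (mulrC df).
by apply: DeriveDef; [apply/cvg_ex; exists df|exact/cvg_lim].
Qed.

Lemma is_derive_div f g x df dg : g x != 0 ->
  is_derive x 1 f df -> is_derive x 1 g dg ->
  is_derive x 1 (fun z => f z / g z) ((df * g x - f x * dg) / g x ^+ 2).
Proof.
move=> gx0 fx gx; apply: is_derive_eq (is_derive1M fx (is_derive1V gx0 gx)) _.
by field.
Qed.

Lemma near_neq0 f x :
  {for x, continuous f} -> f x != 0 -> \forall z \near x, f z != 0.
Proof. exact: (@cvgr_neq0 C C C (nbhs x) _ f (f x)). Qed.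

Lemma is_derive_derive1 f x : derivable f x 1 -> is_derive x 1 f (derive1 f x).
Proof. by rewrite derive1E => /derivableP. Qed.

End Calculus.

(** * Pull-back of a hypergeometric equation along a general map *)

Section PullbackEquation.
Variable C : numFieldType.

(** Here [tau] stands for theta' / theta. Inserting theta * y(phi) into the target equation and
    dividing by theta leaves a combination of y'', y' and y at phi x; the last three fields say that
    its coefficients are [lam x] times those of the source equation. *)
Record pullback_data_at (a b c a' b' c' : C)
    (phi dphi ddphi tau dtau lam : C -> C) (x : C) : Prop := PullbackData {
  pullback_dphi : is_derive x 1 phi (dphi x);
  pullback_ddphi : is_derive x 1 dphi (ddphi x);
  pullback_dtau : is_derive x 1 tau (dtau x);
  pullback_coef2 : x * (1 - x) * dphi x ^+ 2 = lam x * (phi x * (1 - phi x));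
  pullback_coef1 :
    x * (1 - x) * (2 * tau x * dphi x + ddphi x) +
      (c' - (a' + b' + 1) * x) * dphi x = lam x * (c - (a + b + 1) * phi x);
  pullback_coef0 :
    x * (1 - x) * (tau x ^+ 2 + dtau x) +
      (c' - (a' + b' + 1) * x) * tau x - a' * b' = - lam x * (a * b) }.

Lemma hyp_solution_pullback (a b c a' b' c' : C)
    (phi dphi ddphi tau dtau lam theta y : C -> C) (x0 : C) :
  (\forall x \near x0,
    pullback_data_at a b c a' b' c' phi dphi ddphi tau dtau lam x) ->
  (\forall x \near x0, is_derive (x : C) 1 theta (tau x * theta x)) ->
  hyp_solution a b c y (phi x0) ->
  hyp_solution a' b' c' (fun x => theta x * y (phi x)) x0.
Proof.
move=> Hdata Htheta Hy.
have phix0 : {for x0, continuous phi}.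
  exact: is_derive1_continuous (pullback_dphi (nbhs_singleton Hdata)).
have {}Hy := phix0 _ Hy.
set Y := fun x => _.
pose Y1 x := theta x * (tau x * y (phi x) + dphi x * derive1 y (phi x)).
have dY : \forall x \near x0, is_derive (x : C) 1 Y (Y1 x).
  near=> x.
  have [dphix _ _ _ _ _] :
    pullback_data_at a b c a' b' c' phi dphi ddphi tau dtau lam x by near: x.
  have [dy _ _] : [/\ derivable y (phi x) 1, derivable (derive1 y) (phi x) 1 &
    phi x * (1 - phi x) * derive1 (derive1 y) (phi x) +
      (c - (a + b + 1) * phi x) * derive1 y (phi x) - a * b * y (phi x) = 0].
    by near: x.
  have thetax : is_derive (x : C) 1 theta (tau x * theta x) by near: x.
  apply: is_derive_eq (is_derive1M thetax
    (is_derive_chain dphix (derivableP dy))) _.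
  by rewrite /Y1 derive1E; ring.
have Y1E : \forall x \near x0, derive1 Y x = Y1 x.
  by apply: filterS dY => x; exact: derive1_is_derive.
(* The second derivative at x needs the formula for [derive1 Y] on a whole neighbourhood of x, not
   only at x. *)
have {}near_Y1E := near_join Y1E.
rewrite /hyp_solution /=.
near=> x.
have [dphix ddphix dtaux coef2 coef1 coef0] :
  pullback_data_at a b c a' b' c' phi dphi ddphi tau dtau lam x by near: x.
have [dy ddy ode] : [/\ derivable y (phi x) 1, derivable (derive1 y) (phi x) 1 &
    phi x * (1 - phi x) * derive1 (derive1 y) (phi x) +
      (c - (a + b + 1) * phi x) * derive1 y (phi x) - a * b * y (phi x) = 0].
  by near: x.
have thetax : is_derive (x : C) 1 theta (tau x * theta x) by near: x.
pose y2 := derive1 (derive1 y) (phi x).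
pose Y2 := theta x * (
  (tau x ^+ 2 + dtau x) * y (phi x) +
  (2 * tau x * dphi x + ddphi x) * derive1 y (phi x) + dphi x ^+ 2 * y2).
have Y1x : is_derive x 1 (derive1 Y) Y2.
  have nearY1 : \near x, Y1 x = derive1 Y x.
    have : \forall z \near x, derive1 Y z = Y1 z by near: x.
    by apply: filterS.
  apply: near_eq_is_derive nearY1 _.
  have y1 : is_derive (phi x) 1 y (derive1 y (phi x)).
    by rewrite derive1E; exact: derivableP.
  have dy1 : is_derive (phi x) 1 (derive1 y) y2.
    by rewrite /y2 derive1E; exact: derivableP.
  apply: is_derive_eq (is_derive1M thetax (is_derive1D
    (is_derive1M dtaux (is_derive_chain dphix y1))
    (is_derive1M ddphix (is_derive_chain dphix dy1)))) _.
  by rewrite /Y2; ring.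
split.
- by have [] : is_derive x 1 Y (Y1 x) by near: x.
- by case: Y1x.
- rewrite (derive1_is_derive Y1x) (_ : derive1 Y x = Y1 x); last by near: x.
  rewrite /Y2 /Y1 /Y.
  transitivity (theta x * (
    (x * (1 - x) * (tau x ^+ 2 + dtau x) +
      (c' - (a' + b' + 1) * x) * tau x - a' * b') * y (phi x) +
    (x * (1 - x) * (2 * tau x * dphi x + ddphi x) +
      (c' - (a' + b' + 1) * x) * dphi x) * derive1 y (phi x) +
    (x * (1 - x) * dphi x ^+ 2) * y2)); first by ring.
  rewrite coef0 coef1 coef2.
  transitivity (theta x * lam x * (phi x * (1 - phi x) * y2 +
      (c - (a + b + 1) * phi x) * derive1 y (phi x) - a * b * y (phi x))).
    by ring.
  by rewrite ode mulr0.
Unshelve. all: by end_near. Qed.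

End PullbackEquation.

(** * The pull-back identities for [phi1] *)

Section Phi1Pullback.
Variables (C : numFieldType) (omega : C).
Hypothesis omegaP : omega ^+ 2 + omega + 1 = 0.
Implicit Type x : C.

Let omega2 : omega ^+ 2 = - omega - 1.
Proof. by rewrite -[LHS]subr0 -omegaP; ring. Qed.

Definition phi1_lin x : C := (6 * omega + 3) * x + (- 8 - 3 * omega).
Definition phi1_quad x : C :=
  27 * x ^+ 2 - (723 + 1392 * omega) * x + (- 496 + 696 * omega).
(* The points over 1, each of ramification index 2, are the roots of this
   polynomial.  Numerals above 5000 are split, as they denote unary naturals. *)
Definition phi1_quart x : C :=
  (81 + 162 * omega) * x ^+ 4 - (14 * 1000 + 94 + 324 * omega) * x ^+ 3 +
  (56 * 1000 + 421 + (71 * 1000 + 46) * omega) * x ^+ 2 -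
  (28 * 1000 + 304 + (71 * 1000 - 116) * omega) * x -
  (6 * 1000 + 56 - 1992 * omega).

Local Notation L := phi1_lin.
Local Notation Q := phi1_quad.
Local Notation S := phi1_quart.
Let dL : C := 6 * omega + 3.
Let dQ x : C := 54 * x - (723 + 1392 * omega).
Let dS x : C :=
  4 * (81 + 162 * omega) * x ^+ 3
  - 3 * (14 * 1000 + 94 + 324 * omega) * x ^+ 2 +
  2 * (56 * 1000 + 421 + (71 * 1000 + 46) * omega) * x -
  (28 * 1000 + 304 + (71 * 1000 - 116) * omega).

Lemma phi1E x : phi1 omega x = x * (x - 1) * Q x ^+ 3 / (64 * L x ^+ 7).
Proof.
rewrite /phi1 /ratfun /phi1_num /phi1_den !hornerE /=.
by congr (_ / _); rewrite /Q /L; ring.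
Qed.

Lemma phi1_quart_sqr x : 64 * L x ^+ 7 - x * (x - 1) * Q x ^+ 3 = S x ^+ 2.
Proof. by rewrite /L /Q /S; ring: omega2. Qed.

Lemma is_derive_phi1_lin x : is_derive x 1 L dL.
Proof.
apply: is_derive_eq (is_derive1D (is_derive1Z dL (is_derive1_id x))
  (is_derive1_cst (- 8 - 3 * omega) x)) _.
by ring.
Qed.

Let is_derive_quad x : is_derive x 1 Q (dQ x).
Proof.
apply: is_derive_eq (is_derive1D (is_derive1B
   (is_derive1Z 27 (is_derive1X 1 (is_derive1_id x)))
   (is_derive1Z (723 + 1392 * omega) (is_derive1_id x)))
  (is_derive1_cst (- 496 + 696 * omega) x)) _.
by rewrite /dQ; ring.
Qed.

Let is_derive_quart x : is_derive x 1 S (dS x).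
Proof.
apply: is_derive_eq (is_derive1B (is_derive1B (is_derive1D (is_derive1B
   (is_derive1Z _ (is_derive1X 3 (is_derive1_id x)))
   (is_derive1Z _ (is_derive1X 2 (is_derive1_id x))))
   (is_derive1Z _ (is_derive1X 1 (is_derive1_id x))))
   (is_derive1Z _ (is_derive1_id x)))
  (is_derive1_cst _ x)) _.
by rewrite /dS; ring.
Qed.

(** All ramification lies over 0, 1 and infinity, so the numerator of the derivative consists of Q ^
    2 and S only. This agrees with Riemann-Hurwitz: 2 * 2 over 0, 4 over 1 and 6 over infinity add
    up to 2 * 8 - 2. *)
Let dphi x := Q x ^+ 2 * S x / (64 * L x ^+ 8).
Let ddphi x :=
  Q x * (2 * dQ x * S x * L x + Q x * dS x * L x - 8 * dL * Q x * S x) /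
  (64 * L x ^+ 9).
(** The logarithmic derivative of L ^ (-1/12), where 1/12 = 7 * (1/84) comes from the pole of order
    7. *)
Definition phi1_tau x : C := - (1 / 12) * (dL / L x).
Let dtau x : C := 1 / 12 * (dL / L x) ^+ 2.
(** Forced by the coefficient of y'': it is x (1 - x) phi1' ^ 2 / (phi1 (1 - phi1)). *)
Let lam x : C := - Q x / L x ^+ 2.

Lemma phi1_pullback x : L x != 0 ->
  pullback_data_at (1 / 84) (13 / 84) (2 / 3) (2 / 21) (5 / 21) (2 / 3)
    (phi1 omega) dphi ddphi phi1_tau dtau lam x.
Proof.
move=> Lx0.
have one_phi : 1 - phi1 omega x = S x ^+ 2 / (64 * L x ^+ 7).
  rewrite phi1E -phi1_quart_sqr; field.
  by rewrite Lx0.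
split.
- rewrite (_ : phi1 omega = fun x => x * (x - 1) * Q x ^+ 3 / (64 * L x ^+ 7));
    last exact/funext/phi1E.
  apply: is_derive_eq (is_derive_div _ (is_derive1M (is_derive1M
      (is_derive1_id x) (is_derive1B (is_derive1_id x) (is_derive1_cst 1 x)))
    (is_derive1X 2 (is_derive_quad x)))
    (is_derive1Z 64 (is_derive1X 6 (is_derive_phi1_lin x)))) _.
    by rewrite mulf_neq0 ?pnatr_eq0// expf_neq0.
  rewrite /dphi.
  (* The right-hand side is what the quotient rule leaves after Q ^ 2 and L ^ 6 are taken out. That
     it is the same S whose square is the numerator of 1 - phi1 is the first of the identities
     modulo [omega2]. *)
  have -> : S x = (2 * x - 1) * Q x * L x + 3 * x * (x - 1) * dQ x * L x -
      7 * dL * (x * (x - 1)) * Q x.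
    by rewrite /S /L /Q /dL /dQ; ring: omega2.
  by field; rewrite Lx0.
- apply: is_derive_eq (is_derive_div _ (is_derive1M
      (is_derive1X 1 (is_derive_quad x)) (is_derive_quart x))
    (is_derive1Z 64 (is_derive1X 7 (is_derive_phi1_lin x)))) _.
    by rewrite mulf_neq0 ?pnatr_eq0// expf_neq0.
  by rewrite /ddphi; field; rewrite Lx0.
- apply: is_derive_eq (is_derive1Z (- (1 / 12)) (is_derive1Z dL
    (is_derive1V Lx0 (is_derive_phi1_lin x)))) _.
  by rewrite /dtau; field; rewrite Lx0 ?pnatr_eq0.
- by rewrite one_phi /dphi /lam phi1E; field; rewrite Lx0.
(* The coefficient of y' with its factor Q / (64 L ^ 9) removed, so that the relation on [omega] is
   applied to a polynomial identity. The right-hand side is - 64 L ^ 7 * (c - (a + b + 1) phi1). *)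
- have E : x * (1 - x) * (2 * (- (1 / 12)) * dL * Q x * S x +
        2 * dQ x * S x * L x + Q x * dS x * L x - 8 * dL * Q x * S x) +
      (2 / 3 - (2 / 21 + 5 / 21 + 1) * x) * Q x * S x * L x =
      - (2 / 3 * (64 * L x ^+ 7) -
         (1 / 84 + 13 / 84 + 1) * (x * (x - 1) * Q x ^+ 3)).
    by rewrite /S /L /Q /dL /dQ /dS; field: omega2; rewrite ?pnatr_eq0.
  transitivity (Q x / (64 * L x ^+ 9) *
    (x * (1 - x) * (2 * (- (1 / 12)) * dL * Q x * S x +
        2 * dQ x * S x * L x + Q x * dS x * L x - 8 * dL * Q x * S x) +
      (2 / 3 - (2 / 21 + 5 / 21 + 1) * x) * Q x * S x * L x)).
    by rewrite /phi1_tau /dphi /ddphi; field; rewrite Lx0 ?pnatr_eq0.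
  by rewrite E /lam phi1E; field; rewrite Lx0 ?pnatr_eq0.
(* The constant 13/144 is (1/12) ^ 2 + 1/12: both [tau ^+ 2] and [dtau] are multiples of (dL / L) ^
   2. The quadratic that remains is proportional to Q. *)
- have E : x * (1 - x) * (13 / 144 * dL ^+ 2) +
      (2 / 3 - (2 / 21 + 5 / 21 + 1) * x) * (- (1 / 12) * dL) * L x -
      2 / 21 * (5 / 21) * L x ^+ 2 = 1 / 84 * (13 / 84) * Q x.
    by rewrite /L /Q /dL; field: omega2; rewrite ?pnatr_eq0.
  transitivity ((x * (1 - x) * (13 / 144 * dL ^+ 2) +
      (2 / 3 - (2 / 21 + 5 / 21 + 1) * x) * (- (1 / 12) * dL) * L x -
      2 / 21 * (5 / 21) * L x ^+ 2) / L x ^+ 2).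
    by rewrite /phi1_tau /dtau; field; rewrite Lx0 ?pnatr_eq0.
  by rewrite E /lam; field; rewrite Lx0 ?pnatr_eq0.
Qed.

Lemma hyp_solution_phi1 (x0 : C) (theta y : C -> C) : L x0 != 0 ->
  (\forall x \near x0, is_derive (x : C) 1 theta (phi1_tau x * theta x)) ->
  hyp_solution (1 / 84) (13 / 84) (2 / 3) y (phi1 omega x0) ->
  hyp_solution (2 / 21) (5 / 21) (2 / 3) (fun x => theta x * y (phi1 omega x)) x0.
Proof.
move=> Lx0; apply: hyp_solution_pullback.
have := near_neq0 (is_derive1_continuous (is_derive_phi1_lin x0)) Lx0.
by apply: filterS => x; exact: phi1_pullback.
Qed.

End Phi1Pullback.

(** * The pull-back identities for 1 / phi1 (1 / x) *)

Section Phi1ReversedPullback.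
Variables (C : numFieldType) (omega : C).
Hypothesis omegaP : omega ^+ 2 + omega + 1 = 0.
Implicit Type x : C.

Let omega2 : omega ^+ 2 = - omega - 1.
Proof. by rewrite -[LHS]subr0 -omegaP; ring. Qed.

(** This and the next two are the reversed polynomials x L(1/x), x ^ 2 Q(1/x) and x ^ 4 S(1/x). *)
Definition phi1_rlin x : C := 6 * omega + 3 - (8 + 3 * omega) * x.
Definition phi1_rquad x : C :=
  27 - (723 + 1392 * omega) * x + (- 496 + 696 * omega) * x ^+ 2.
Definition phi1_rquart x : C :=
  81 + 162 * omega - (14 * 1000 + 94 + 324 * omega) * x +
  (56 * 1000 + 421 + (71 * 1000 + 46) * omega) * x ^+ 2 -
  (28 * 1000 + 304 + (71 * 1000 - 116) * omega) * x ^+ 3 -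
  (6 * 1000 + 56 - 1992 * omega) * x ^+ 4.

Local Notation L := phi1_rlin.
Local Notation Q := phi1_rquad.
Local Notation S := phi1_rquart.
Let dL : C := - (8 + 3 * omega).
Let dQ x : C := 2 * (- 496 + 696 * omega) * x - (723 + 1392 * omega).
Let dS x : C :=
  - (14 * 1000 + 94 + 324 * omega) +
  2 * (56 * 1000 + 421 + (71 * 1000 + 46) * omega) * x -
  3 * (28 * 1000 + 304 + (71 * 1000 - 116) * omega) * x ^+ 2 -
  4 * (6 * 1000 + 56 - 1992 * omega) * x ^+ 3.

(** Powers of 1/x are cleared, so that this form can be differentiated at 0. *)
Definition phi1_inv x : C := 64 * x * L x ^+ 7 / ((1 - x) * Q x ^+ 3).

Lemma phi1_invE x : 1 / phi1 omega (1 / x) = phi1_inv x.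
Proof.
(* At 0 both sides vanish: 1 / 0 is 0, [phi1] vanishes at 0, and the outer inverse of 0 is 0
   again. *)
have [->|x0] := eqVneq x 0.
  by rewrite /phi1_inv invr0 mulr0 phi1E !mulr0 !mul0r invr0 mulr0.
rewrite phi1E /phi1_inv.
have -> : phi1_lin omega (1 / x) = L x / x by rewrite /phi1_lin /L; field.
have -> : phi1_quad omega (1 / x) = Q x / x ^+ 2.
  by rewrite /phi1_quad /Q; field.
have -> : 1 / x * (1 / x - 1) * (Q x / x ^+ 2) ^+ 3 =
    (1 - x) * Q x ^+ 3 / x ^+ 8 by field.
have -> : 64 * (L x / x) ^+ 7 = 64 * L x ^+ 7 / x ^+ 7 by field.
(* The denominator may vanish. With its inverse abstracted as [d], the equality asks only for x
   nonzero and also covers the default value of the inverse. *)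
rewrite div1r invf_div invf_div; set d := ((1 - x) * _)^-1.
by field.
Qed.

Lemma phi1_rquart_sqr x :
  64 * x * L x ^+ 7 - (1 - x) * Q x ^+ 3 = S x ^+ 2.
Proof. by rewrite /L /Q /S; ring: omega2. Qed.

Let is_derive_lin x : is_derive x 1 L dL.
Proof.
apply: is_derive_eq (is_derive1B (is_derive1_cst _ x)
  (is_derive1Z _ (is_derive1_id x))) _.
by rewrite /dL; ring.
Qed.

Let is_derive_quad x : is_derive x 1 Q (dQ x).
Proof.
apply: is_derive_eq (is_derive1D (is_derive1B (is_derive1_cst _ x)
   (is_derive1Z _ (is_derive1_id x)))
   (is_derive1Z _ (is_derive1X 1 (is_derive1_id x)))) _.
by rewrite /dQ; ring.
Qed.

Let is_derive_quart x : is_derive x 1 S (dS x).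
Proof.
apply: is_derive_eq (is_derive1B (is_derive1B (is_derive1D (is_derive1B
   (is_derive1_cst _ x)
   (is_derive1Z _ (is_derive1_id x)))
   (is_derive1Z _ (is_derive1X 1 (is_derive1_id x))))
   (is_derive1Z _ (is_derive1X 2 (is_derive1_id x))))
   (is_derive1Z _ (is_derive1X 3 (is_derive1_id x)))) _.
by rewrite /dS; ring.
Qed.

Let is_derive_1x x : is_derive x 1 (fun z : C => 1 - z) (- 1).
Proof.
by apply: is_derive_eq (is_derive1B (is_derive1_cst 1 x) (is_derive1_id x)) _; ring.
Qed.

Let dphi x := 64 * L x ^+ 6 * S x / ((1 - x) ^+ 2 * Q x ^+ 4).
Let ddphi x :=
  64 * L x ^+ 5 * ((6 * dL * S x + L x * dS x) * (1 - x) * Q x -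
    L x * S x * (4 * (1 - x) * dQ x - 2 * Q x)) /
  ((1 - x) ^+ 3 * Q x ^+ 5).
(** [phi1_rtau] is [U / V]; writing it over one denominator makes [dtau] a single quotient and the
    identity for the coefficient of y polynomial after multiplication by [V ^+ 2]. *)
Let V x := (1 - x) * Q x.
Let dV x := (1 - x) * dQ x - Q x.
Let U x := 1 / 84 * Q x - 1 / 28 * dQ x * (1 - x).
Let dU x := 1 / 84 * dQ x + 1 / 28 * dQ x -
  1 / 28 * (2 * (- 496 + 696 * omega)) * (1 - x).
(** The logarithmic derivative of (1 - x) ^ (-1/84) Q ^ (-1/28): a pole of order m of [phi1_inv]
    requires the exponent - m / 84, with m = 1 at 1 and m = 3 at the zeros of Q. *)
Definition phi1_rtau x : C :=
  1 / 84 / (1 - x) - 1 / 28 *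
    (2 * (- 496 + 696 * omega) * x - (723 + 1392 * omega)) / Q x.
Let dtau x : C := (dU x * V x - U x * dV x) / V x ^+ 2.
Let lam x : C := - 64 * L x ^+ 5 / ((1 - x) * Q x ^+ 2).

Lemma phi1_rpullback x : 1 - x != 0 -> Q x != 0 ->
  pullback_data_at (1 / 84) (29 / 84) (6 / 7) (2 / 21) (3 / 7) (6 / 7)
    phi1_inv dphi ddphi phi1_rtau dtau lam x.
Proof.
move=> x1 Qx0.
have one_phi : 1 - phi1_inv x = - S x ^+ 2 / ((1 - x) * Q x ^+ 3).
  rewrite /phi1_inv -phi1_rquart_sqr; field.
  by rewrite x1 Qx0.
split.
- apply: is_derive_eq (is_derive_div _ (is_derive1M
      (is_derive1Z 64 (is_derive1_id x)) (is_derive1X 6 (is_derive_lin x)))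
    (is_derive1M (is_derive_1x x) (is_derive1X 2 (is_derive_quad x)))) _.
    by rewrite mulf_neq0// expf_neq0.
  rewrite /dphi.
  have -> : S x = (L x + 7 * x * dL) * (1 - x) * Q x -
      x * L x * (3 * (1 - x) * dQ x - Q x).
    by rewrite /S /L /Q /dL /dQ; ring: omega2.
  by field; rewrite x1 Qx0.
- apply: is_derive_eq (is_derive_div _ (is_derive1M (is_derive1Z 64
      (is_derive1X 5 (is_derive_lin x))) (is_derive_quart x))
    (is_derive1M (is_derive1X 1 (is_derive_1x x))
       (is_derive1X 3 (is_derive_quad x)))) _.
    by rewrite mulf_neq0// expf_neq0.
  by rewrite /ddphi; field; rewrite x1 Qx0.
- apply: is_derive_eq (is_derive1B
    (is_derive1Z (1 / 84)
      (is_derive1V (f := fun z => 1 - z) x1 (is_derive_1x x)))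
    (is_derive_div Qx0 (is_derive1Z (1 / 28) (is_derive1B
      (is_derive1Z (2 * (- 496 + 696 * omega)) (is_derive1_id x))
      (is_derive1_cst (723 + 1392 * omega) x))) (is_derive_quad x))) _.
  rewrite /dtau /dU /U /V /dV -/(dQ x).
  by field; rewrite ?x1 ?Qx0 ?pnatr_eq0.
- by rewrite one_phi /dphi /lam /phi1_inv; field; rewrite x1 Qx0.
- have E : x * (1 - x) * (2 * U x * L x * S x +
        (6 * dL * S x + L x * dS x) * V x -
        L x * S x * (4 * (1 - x) * dQ x - 2 * Q x)) +
      (6 / 7 - (2 / 21 + 3 / 7 + 1) * x) * V x * L x * S x =
      - (1 - x) * (6 / 7 * ((1 - x) * Q x ^+ 3) -
         (1 / 84 + 29 / 84 + 1) * (64 * x * L x ^+ 7)).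
    by rewrite /U /V /S /L /Q /dL /dQ /dS; field: omega2; rewrite ?pnatr_eq0.
  transitivity (64 * L x ^+ 5 / ((1 - x) ^+ 3 * Q x ^+ 5) *
    (x * (1 - x) * (2 * U x * L x * S x +
        (6 * dL * S x + L x * dS x) * V x -
        L x * S x * (4 * (1 - x) * dQ x - 2 * Q x)) +
      (6 / 7 - (2 / 21 + 3 / 7 + 1) * x) * V x * L x * S x)).
    rewrite /phi1_rtau /dphi /ddphi /U /V -/(dQ x).
    by field; rewrite ?x1 ?Qx0 ?pnatr_eq0.
  by rewrite E /lam /phi1_inv; field; rewrite x1 Qx0 ?pnatr_eq0.
- have E : x * (1 - x) * (U x ^+ 2 + dU x * V x - U x * dV x) +
      (6 / 7 - (2 / 21 + 3 / 7 + 1) * x) * U x * V x -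
      2 / 21 * (3 / 7) * V x ^+ 2 =
      1 / 84 * (29 / 84) * 64 * L x ^+ 5 * (1 - x).
    rewrite /U /V /dU /dV /L /Q /dQ.
    by field: omega2; rewrite ?pnatr_eq0.
  have V0 : V x != 0 by rewrite mulf_neq0.
  transitivity ((x * (1 - x) * (U x ^+ 2 + dU x * V x - U x * dV x) +
      (6 / 7 - (2 / 21 + 3 / 7 + 1) * x) * U x * V x -
      2 / 21 * (3 / 7) * V x ^+ 2) / V x ^+ 2).
    have -> : phi1_rtau x = U x / V x.
      rewrite /phi1_rtau /U /V -/(dQ x).
      by field; rewrite ?x1 ?Qx0 ?pnatr_eq0.
    by rewrite /dtau; field; rewrite ?V0 ?pnatr_eq0.
  by rewrite E /lam /V; field; rewrite ?x1 ?Qx0 ?pnatr_eq0.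
Qed.

Lemma hyp_solution_phi1_inv (x0 : C) (theta y : C -> C) :
  1 - x0 != 0 -> Q x0 != 0 ->
  (\forall x \near x0, is_derive (x : C) 1 theta (phi1_rtau x * theta x)) ->
  hyp_solution (1 / 84) (29 / 84) (6 / 7) y (phi1_inv x0) ->
  hyp_solution (2 / 21) (3 / 7) (6 / 7) (fun x => theta x * y (phi1_inv x)) x0.
Proof.
move=> x1 Qx0; apply: hyp_solution_pullback.
have nx := near_neq0 (is_derive1_continuous (is_derive_1x x0)) x1.
have nQ := near_neq0 (is_derive1_continuous (is_derive_quad x0)) Qx0.
near=> x; apply: phi1_rpullback; near: x; [exact: nx|exact: nQ].
Unshelve. all: by end_near. Qed.

End Phi1ReversedPullback.

(** * Norm, real and imaginary parts, and the complex exponential *)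

Lemma near_dist_le (K : numFieldType) (z e : K) : 0 < e ->
  \forall w \near z, `|z - w| <= e.
Proof.
move=> e0; apply/nbhs_ballP; exists e => //= w; exact: ltW.
Qed.

(** Source and target fields are distinct because the maps in question go from C to R ([Re], [Im])
    and from R to C (rays). *)
Lemma continuous_dist_le (K K' : numFieldType) (f : K -> K') :
  (forall (z : K) (e : K'), 0 < e -> exists2 d : K, 0 < d &
     forall w, `|z - w| <= d -> `|f z - f w| <= e) -> continuous f.
Proof.
move=> Hf z; apply/(@cvgrPdist_le _ _ _ (nbhs z)) => e /(Hf z)[d d0 zd].
have := near_dist_le z d0.
by apply: filterS => w; exact: zd.
Qed.

Section ComplexNorm.
Variable R : realType.
Local Notation C := (Cplx R).
Implicit Type z : C.

Lemma Re_le_norm z : `|complex.Re z|%:C <= `|z|.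
Proof. exact: normc_ge_Re. Qed.

Lemma CplxnormE z :
  `|z| = (Num.sqrt (complex.Re z ^+ 2 + complex.Im z ^+ 2))%:C.
Proof. exact: normc_def. Qed.

Lemma Im_le_norm z : `|complex.Im z|%:C <= `|z|.
Proof.
rewrite CplxnormE lecR -sqrtr_sqr ler_sqrt ?lerDr ?sqr_ge0//.
by rewrite addr_ge0 ?sqr_ge0.
Qed.

Lemma norm_le_ReIm z : `|z| <= (`|complex.Re z| + `|complex.Im z|)%:C.
Proof.
rewrite CplxnormE lecR -[leRHS]ger0_norm ?addr_ge0// -(sqrtr_sqr (_ + _)).
rewrite ler_sqrt ?sqr_ge0//.
rewrite sqrrD !real_normK ?num_real// lerD2r lerDl.
by rewrite mulrn_wge0 ?mulr_ge0.
Qed.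

(** Complex numbers are comparable only when their imaginary parts agree; this turns every positive
    complex epsilon into a real one. *)
Lemma gt0_realP (e : C) : 0 < e -> exists2 r : R, 0 < r & e = r%:C.
Proof.
case: e => a b; rewrite ltcE /= => /andP[/eqP -> a0]; by exists a.
Qed.

Lemma continuous_Re : continuous (@complex.Re R : C -> R).
Proof.
apply: continuous_dist_le => z e e0; exists e%:C; first by rewrite ltcR.
move=> w; rewrite -lecR; apply: le_trans.
rewrite (_ : complex.Re z - complex.Re w = complex.Re (z - w)).
  exact: Re_le_norm.
by case: (z) (w) => [? ?] [? ?].
Qed.

Lemma continuous_Im : continuous (@complex.Im R : C -> R).
Proof.
apply: continuous_dist_le => z e e0; exists e%:C; first by rewrite ltcR.
move=> w; rewrite -lecR; apply: le_trans.
rewrite (_ : complex.Im z - complex.Im w = complex.Im (z - w)).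
  exact: Im_le_norm.
by case: (z) (w) => [? ?] [? ?].
Qed.

Lemma cexp0 : cexp (0 : C) = 1.
Proof. by rewrite /cexp /= expR0 cos0 sin0 mul1r mulr0. Qed.

Lemma cexpD (a b : C) : cexp (a + b) = cexp a * cexp b.
Proof.
case: a b => [a1 a2] [b1 b2]; apply/eqP; rewrite eq_complex /= expRD cosD sinD.
by apply/andP; split; apply/eqP; ring.
Qed.

Lemma cexp_neq0 (a : C) : cexp a != 0.
Proof.
apply/negP => /eqP a0; have /eqP := cexp0.
by rewrite -(subrr a) cexpD a0 mul0r eq_sym oner_eq0.
Qed.

Let real_deriv0 (f : R -> R) (df e : R) : is_derive (0 : R) 1 f df -> 0 < e ->
  \forall u \near (0 : R), `|f u - f 0 - u * df| <= e * `|u|.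
Proof.
by move=> /is_deriveP/[apply]; apply: filterS => u; rewrite add0r.
Qed.

(** With h = u + iv, the real part of the error is (e^u - 1 - u) + e^u (cos v - 1) and the imaginary
    part is e^u (sin v - v) + v (e^u - 1). Since e^u <= 2 near 0, the four terms contribute 1 + 2 +
    2 + 1 = 6. *)
Let cexp_near0 (e : R) : 0 < e ->
  \forall h \near (0 : C), `|cexp h - 1 - h| <= (e * 6)%:C * `|h|.
Proof.
move=> e0.
have E1 := real_deriv0 (is_derive_expR 0) e0.
have E2 := real_deriv0 (is_derive_cos 0) e0.
have E3 := real_deriv0 (is_derive_sin 0) e0.
have E4 : \forall u \near (0 : R), `|expR u - 1| <= e.
  have /(@cvgr_dist_le _ _ _ _)/(_ _ e0) := @continuous_expR R 0.
  by rewrite expR0; apply: filterS => u; rewrite distrC.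
have E5 : \forall u \near (0 : R), `|expR u - 1| <= 1.
  have /(@cvgr_dist_le _ _ _ _)/(_ _ ltr01) := @continuous_expR R 0.
  by rewrite expR0; apply: filterS => u; rewrite distrC.
have R0 := @continuous_Re 0; have I0 := @continuous_Im 0.
have {E1} E1 := R0 _ E1; have {E4} E4 := R0 _ E4; have {E5} E5 := R0 _ E5.
have {E2} E2 := I0 _ E2; have {E3} E3 := I0 _ E3.
near=> h.
have : `|expR (complex.Re h) - expR 0 - complex.Re h * expR 0| <=
  e * `|complex.Re h| by near: h.
have : `|cos (complex.Im h) - cos 0 - complex.Im h * - sin 0| <=
  e * `|complex.Im h| by near: h.
have : `|sin (complex.Im h) - sin 0 - complex.Im h * cos 0| <=
  e * `|complex.Im h| by near: h.
have : `|expR (complex.Re h) - 1| <= e by near: h.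
have : `|expR (complex.Re h) - 1| <= 1 by near: h.
rewrite expR0 cos0 sin0 !(oppr0, mulr0, mulr1, addr0).
have := Re_le_norm h; have := Im_le_norm h.
rewrite (CplxnormE h) !lecR -rmorphM /=.
set n := Num.sqrt _; set u := complex.Re h; set v := complex.Im h.
move=> vn un H5 H4 H3 H2 H1.
have n0 : 0 <= n by apply: le_trans un.
have U0 : `|expR u| <= 2.
  by rewrite -(subrK 1 (expR u)) (le_trans (ler_normD _ _))// normr1 (natrD _ 1 1) lerD2r.
have Hc : `|expR u * (cos v - 1)| <= 2 * (e * n).
  by rewrite normrM ler_pM// (le_trans H2)// ler_wpM2l// ltW.
have Hs : `|expR u * (sin v - v)| <= 2 * (e * n).
  by rewrite normrM ler_pM// (le_trans H3)// ler_wpM2l// ltW.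
have Hv : `|v * (expR u - 1)| <= n * e by rewrite normrM ler_pM.
have Hu : `|expR u - 1 - u| <= e * n.
  by rewrite (le_trans H1)// ler_wpM2l// ltW.
apply: le_trans (norm_le_ReIm _) _; rewrite lecR.
have -> : complex.Re (cexp h - 1 - h) =
    (expR u - 1 - u) + expR u * (cos v - 1).
  by rewrite /u /v; case: (h) => ? ? /=; ring.
have -> : complex.Im (cexp h - 1 - h) =
    expR u * (sin v - v) + v * (expR u - 1).
  by rewrite /u /v; case: (h) => ? ? /=; ring.
apply: le_trans (lerD (ler_normD _ _) (ler_normD _ _)) _.
apply: le_trans (lerD (lerD Hu Hc) (lerD Hs Hv)) _.
by rewrite le_eqVlt; apply/orP; left; apply/eqP; ring.
Unshelve. all: by end_near. Qed.

(** The addition formula carries the estimate at 0 to x at the cost of the factor |cexp x|, which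
    the choice e / (6 |cexp x|) absorbs. *)
Lemma is_derive_cexp (x : C) : is_derive x 1 (@cexp R) (cexp x).
Proof.
apply/is_deriveP => _ /gt0_realP[e e0 ->].
have /gt0_realP[n n0 nE] : 0 < `|cexp x| by rewrite normr_gt0 cexp_neq0.
have e1 : 0 < e / (n * 6) by rewrite divr_gt0// mulr_gt0.
have := cexp_near0 e1; apply: filterS => h Hh.
have -> : cexp (x + h) - cexp x - h * cexp x = cexp x * (cexp h - 1 - h).
  by rewrite cexpD; ring.
rewrite normrM nE; have n0C : 0 <= n%:C :> C by rewrite lecR ltW.
apply: le_trans (ler_wpM2l n0C Hh) _; rewrite mulrA -rmorphM.
suff -> : n * (e / (n * 6) * 6) = e by [].
by field; exact: lt0r_neq0.
Qed.

End ComplexNorm.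

(** * Convergence and termwise differentiation of power series *)

Section PowerSeries.
Variable K : numFieldType.
Implicit Types (a b : nat -> K) (z h : K).

Lemma norm_lim_le (u : nat -> K) (l k : K) :
  u @ \oo --> l -> (forall n, `|u n| <= k) -> `|l| <= k.
Proof.
move=> ul uk; apply/ler_addgt0Pl => e e0.
have /cvgrPdist_le/(_ e e0)[N _ /(_ N (leqnn N)) Nl] := ul.
by rewrite -(subrK (u N) l) (le_trans (ler_normD _ _))// lerD.
Qed.

Definition psum a z : K := limn (series (fun n => a n * z ^+ n)).

Definition psum_converges a z := cvgn (series (fun n => a n * z ^+ n)).

(** A usable form of positive radius of convergence, stable under formal differentiation. *)
Definition geom_bounded a := exists M rho : K,
  [/\ 0 < M, 0 < rho & forall n, `|a n| <= M * rho ^+ n].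

Lemma psum0 a : psum a 0 = a 0%N.
Proof.
apply: cvg_lim => //; rewrite -cvg_shiftS.
rewrite (_ : (fun n => _) = fun=> a 0%N); first exact: cvg_cst.
apply/funext => n; rewrite /series /= big_nat_recl// big1 ?addr0.
  by rewrite expr0 mulr1.
by move=> i _; rewrite exprS mul0r mulr0.
Qed.

Definition psum_diff a : nat -> K := fun n => n.+1%:R * a n.+1.

(** The factor n + 1 is at most 2 ^ n, so doubling [rho] absorbs it. *)
Lemma psum_diff_le (M rho : K) a : 0 < M -> 0 < rho ->
  (forall n, `|a n| <= M * rho ^+ n) ->
  forall n, `|psum_diff a n| <= M * rho * (2 * rho) ^+ n.
Proof.
move=> M0 rho0 aM n; rewrite normrM normr_nat.
apply: le_trans (ler_wpM2l _ (aM _)) _ => //.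
have : (n.+1%:R : K) <= 2 ^+ n by rewrite -natrX ler_nat ltn_expl.
have Mrho0 : 0 <= M * rho ^+ n.+1 by rewrite mulr_ge0 ?exprn_ge0 ?ltW.
move=> /(ler_wpM2r Mrho0)/le_trans; apply.
by rewrite exprMn exprS le_eqVlt; apply/orP; left; apply/eqP; ring.
Qed.

Lemma geom_bounded_psum_diff a : geom_bounded a -> geom_bounded (psum_diff a).
Proof.
move=> [M [rho [M0 rho0 aM]]]; exists (M * rho), (2 * rho).
by split; [exact: mulr_gt0|exact: mulr_gt0|exact: psum_diff_le].
Qed.

Section Radius.
Variables (M r : K) (a : nat -> K).
Hypotheses (r0 : 0 < r) (aM : forall n, `|a n| <= M * (4 * r)^-1 ^+ n).

(** Induction: the error of exponent n + 2 is (z + h) times the previous one plus (n + 1) z ^ n h ^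
    2. Multiplying by r ^ 2 avoids negative powers of r. *)
Let term_bound z h n : `|z| <= r -> `|z + h| <= r ->
  `|(z + h) ^+ n.+1 - z ^+ n.+1 - h * (n.+1%:R * z ^+ n)| * r ^+ 2 <=
  (2 * r) ^+ n.+1 * `|h| ^+ 2.
Proof.
move=> zr zhr; have s0 := ltW r0.
elim: n => [|n IHn].
  have -> : (z + h) ^+ 1 - z ^+ 1 - h * (1%:R * z ^+ 0) = 0 by ring.
  by rewrite normr0 mul0r mulr_ge0 ?exprn_ge0 ?mulr_ge0.
have -> : (z + h) ^+ n.+2 - z ^+ n.+2 - h * (n.+2%:R * z ^+ n.+1) =
    (z + h) * ((z + h) ^+ n.+1 - z ^+ n.+1 - h * (n.+1%:R * z ^+ n)) +
    n.+1%:R * z ^+ n * h ^+ 2.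
  by rewrite -(natr1 n.+1) !exprS; ring.
apply: le_trans (ler_wpM2r _ (ler_normD _ _)) _; first exact: exprn_ge0.
rewrite mulrDl [`|(z + h) * _|]normrM -mulrA.
have H1 := ler_pM (normr_ge0 _) (mulr_ge0 (normr_ge0 _) (exprn_ge0 2 s0)) zhr IHn.
have H2 : `|n.+1%:R * z ^+ n * h ^+ 2| * r ^+ 2 <=
    2 ^+ n.+1 * r ^+ n * `|h| ^+ 2 * r ^+ 2.
  rewrite ler_wpM2r ?exprn_ge0// !normrM !normrX normr_nat ler_wpM2r ?exprn_ge0//.
  rewrite ler_pM ?exprn_ge0// ?lerXn2r ?nnegrE ?normr_ge0//.
  by rewrite -natrX ler_nat ltnW// ltn_expl.
apply: le_trans (lerD H1 H2) _.
by rewrite le_eqVlt; apply/orP; left; apply/eqP; rewrite !exprMn !exprS; ring.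
Qed.

(** Of the 4 in (4 r)^-1, one factor 2 cancels the (2 r) ^ n of [term_bound], and the other leaves a
    geometric series of ratio 1/2. Its exact partial sum 1 - 2 ^ (-N) closes the induction. The
    series of [a] has one term more because differentiation lowers the index. *)
Let sum_bound z h N : `|z| <= r -> `|z + h| <= r ->
  `|series (fun n => a n * (z + h) ^+ n) N.+1 -
    series (fun n => a n * z ^+ n) N.+1 -
    h * series (fun n => psum_diff a n * z ^+ n) N| <=
  (M * (1 - 2^-1 ^+ N) / r ^+ 2) * `|h| ^+ 2.
Proof.
move=> zr zhr; rewrite /series /=; elim: N => [|N IHN].
  rewrite !big_nat1 !big_nil !expr0.
  have -> : a 0%N * 1 - a 0%N * 1 - h * 0 = 0 by ring.
  by rewrite normr0 subrr mulr0 !mul0r.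
rewrite big_nat_recr//= [X in _ - X - _]big_nat_recr//= [X in h * X]big_nat_recr//=.
set e := (z + h) ^+ N.+1 - z ^+ N.+1 - h * (N.+1%:R * z ^+ N).
move: IHN; set S1 := \sum_(0 <= i < N.+1) _; set S2 := \sum_(0 <= i < N.+1) _.
set S3 := \sum_(0 <= i < N) _ => IHN.
have -> : S1 + a N.+1 * (z + h) ^+ N.+1 - (S2 + a N.+1 * z ^+ N.+1) -
    h * (S3 + psum_diff a N * z ^+ N) = (S1 - S2 - h * S3) + a N.+1 * e.
  by rewrite /e /psum_diff; ring.
apply: le_trans (ler_normD _ _) _.
have e_le : `|e| <= (2 * r) ^+ N.+1 * `|h| ^+ 2 / r ^+ 2.
  by rewrite ler_pdivlMr ?exprn_gt0//; exact: term_bound.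
have ae_le : `|a N.+1 * e| <= (M * 2^-1 ^+ N.+1 / r ^+ 2) * `|h| ^+ 2.
  rewrite normrM (le_trans (ler_pM _ _ (aM _) e_le))//.
  rewrite le_eqVlt; apply/orP; left; apply/eqP.
  have -> : (4 * r)^-1 = 2^-1 * (2 * r)^-1 by field; rewrite gt_eqF.
  rewrite exprMn (exprVn (2 * r)); move: (2^-1 ^+ _) => t; field.
  by rewrite !gt_eqF// exprn_gt0// mulr_gt0.
apply: le_trans (lerD IHN ae_le) _.
rewrite -mulrDl; suff -> : M * (1 - 2^-1 ^+ N) / r ^+ 2 +
    M * 2^-1 ^+ N.+1 / r ^+ 2 = M * (1 - 2^-1 ^+ N.+1) / r ^+ 2 by [].
by rewrite (exprS _ N); move: (2^-1 ^+ _) => t; field; rewrite gt_eqF.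
Qed.

Lemma psum_diff_bound z h : `|z| <= r -> `|z + h| <= r ->
  psum_converges a (z + h) -> psum_converges a z ->
  psum_converges (psum_diff a) z ->
  `|psum a (z + h) - psum a z - h * psum (psum_diff a) z| <=
    M / r ^+ 2 * `|h| ^+ 2.
Proof.
move=> zr zhr c1 c2 c3.
have {}c1 : series (fun n => a n * (z + h) ^+ n) n.+1 @[n --> \oo] -->
    psum a (z + h) by rewrite cvg_shiftS.
have {}c2 : series (fun n => a n * z ^+ n) n.+1 @[n --> \oo] --> psum a z.
  by rewrite cvg_shiftS.
have {}c3 : series (fun n => psum_diff a n * z ^+ n) n @[n --> \oo] -->
    psum (psum_diff a) z by [].
apply: (@norm_lim_le (fun N => series (fun n => a n * (z + h) ^+ n) N.+1 -
  series (fun n => a n * z ^+ n) N.+1 -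
  h * series (fun n => psum_diff a n * z ^+ n) N)) => [|N].
  by apply: cvgB; [exact: cvgB|exact: cvgMl_tmp].
apply: le_trans (sum_bound N zr zhr) _.
have M0 : 0 <= M by have := aM 0; rewrite expr0 mulr1; exact: le_trans.
have r2 : 0 <= (r ^+ 2)^-1 by rewrite invr_ge0 exprn_ge0// ltW.
rewrite ler_wpM2r ?exprn_ge0// ler_wpM2r//.
by rewrite ler_piMr// gerBl exprn_ge0.
Qed.

End Radius.
End PowerSeries.

Section ComplexPowerSeries.
Variable R : realType.
Local Notation C := (Cplx R).
Implicit Types (a b u : nat -> C) (z h : C).

Lemma cvgn_complex u (l : C) :
  (fun n => complex.Re (u n)) @ \oo --> complex.Re l ->
  (fun n => complex.Im (u n)) @ \oo --> complex.Im l -> u @ \oo --> l.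
Proof.
move=> ul vl; apply/(@cvgrPdist_le C C) => _ /gt0_realP[e e0 ->].
have e2 : 0 < e / 2 by rewrite divr_gt0.
have /cvgrPdist_le/(_ _ e2) Hu := ul.
have /cvgrPdist_le/(_ _ e2) Hv := vl.
near=> n.
apply: le_trans (norm_le_ReIm _) _; rewrite lecR [leRHS](splitr e) lerD//.
  have : `|complex.Re l - complex.Re (u n)| <= e / 2 by near: n.
  by case: (l) (u n) => [? ?] [? ?].
have : `|complex.Im l - complex.Im (u n)| <= e / 2 by near: n.
by case: (l) (u n) => [? ?] [? ?].
Unshelve. all: by end_near. Qed.

(** Absolute convergence in C is reduced to the real comparison test for the real and imaginary
    parts, both dominated by the norm. *)
Lemma cvgn_series_norm_le u (v : nat -> R) :
  (forall n, `|u n| <= (v n)%:C) -> cvgn (series v) -> cvgn (series u).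
Proof.
move=> uv cv.
have v0 n : 0 <= v n by rewrite -lecR (le_trans _ (uv n))// normr_ge0.
have cRe : cvgn (series (fun n => complex.Re (u n))).
  apply: normed_cvg; apply: series_le_cvg cv => //= n.
  by rewrite -lecR (le_trans (Re_le_norm _)).
have cIm : cvgn (series (fun n => complex.Im (u n))).
  apply: normed_cvg; apply: series_le_cvg cv => //= n.
  by rewrite -lecR (le_trans (Im_le_norm _)).
apply/cvg_ex.
exists (limn (series (fun n => complex.Re (u n))) +i*
        limn (series (fun n => complex.Im (u n)))).
apply: cvgn_complex => /=.
  rewrite (_ : (fun n => _) = series (fun n => complex.Re (u n)))//.
  apply/funext => n; rewrite /series /=.
  by apply: (big_morph (@complex.Re R)) => // -[? ?] [? ?].
rewrite (_ : (fun n => _) = series (fun n => complex.Im (u n)))//.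
apply/funext => n; rewrite /series /=.
by apply: (big_morph (@complex.Im R)) => // -[? ?] [? ?].
Qed.

Lemma psum_converges_le (M rho z : C) a : 0 < M -> 0 < rho ->
  (forall n, `|a n| <= M * rho ^+ n) -> `|z| <= (2 * rho)^-1 ->
  psum_converges a z.
Proof.
move=> /[dup] M0 /gt0_realP[m m0 mE] rho0 aM zr.
apply: (@cvgn_series_norm_le _ (geometric m 2^-1)); last first.
  apply: is_cvg_geometric_series.
  by rewrite ger0_norm ?invr_ge0// invf_lt1// ltr1n.
move=> n /=; rewrite normrM normrX.
have r2 : 0 <= (2 * rho)^-1 by rewrite invr_ge0 mulr_ge0// ltW.
have zn : `|z| ^+ n <= (2 * rho)^-1 ^+ n by rewrite lerXn2r.
apply: le_trans (ler_pM _ (exprn_ge0 _ _) (aM n) zn) _ => //.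
rewrite rmorphM /= rmorphXn fmorphV rmorph_nat -mE.
have rhon : rho ^+ n != 0 by rewrite expf_neq0// gt_eqF.
rewrite invfM exprMn (exprVn rho) le_eqVlt; apply/orP; left; apply/eqP.
by move: (2^-1 ^+ n) => t; field.
Qed.

Lemma near_psum_converges a : geom_bounded a ->
  \forall z \near (0 : C), psum_converges a z.
Proof.
move=> [M [rho [M0 rho0 aM]]].
have r0 : 0 < (2 * rho)^-1 by rewrite invr_gt0 mulr_gt0.
have := near_dist_le (0 : C) r0; apply: filterS => z.
by rewrite sub0r normrN; exact: (psum_converges_le M0 rho0 aM).
Qed.

(** The error is at most (M / r ^ 2) |h| ^ 2 with r = 1 / (4 rho), hence at most e |h| once |h| <= e
    r ^ 2 / M. Keeping z and h within r / 2 keeps z + h within r, where all the series involved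
    converge. *)
Lemma is_derive_psum a : geom_bounded a ->
  \forall z \near (0 : C), is_derive (z : C) 1 (psum a) (psum (psum_diff a) z).
Proof.
move=> [M [rho [M0 rho0 aM]]].
pose r := (4 * rho)^-1; have r0 : 0 < r by rewrite invr_gt0 mulr_gt0.
have r2 : 0 < r / 2 by rewrite divr_gt0.
have rho4 : (4 * r)^-1 = rho by rewrite /r; field; rewrite gt_eqF.
have aM' n : `|a n| <= M * (4 * r)^-1 ^+ n by rewrite rho4.
have r_le : r <= (2 * rho)^-1.
  rewrite /r lef_pV2 ?posrE ?mulr_gt0// ler_pM2r//.
  by rewrite ler_nat.
have := near_dist_le (0 : C) r2; apply: filterS => z.
rewrite sub0r normrN => zr2.
have zr : `|z| <= r by rewrite (le_trans zr2)// ler_pdivrMr// ler_peMr ?ler1n// ltW.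
apply/is_deriveP => e e0.
pose K := M / r ^+ 2; have K0 : 0 < K by rewrite divr_gt0// exprn_gt0.
have eK : 0 < e / K by rewrite divr_gt0.
have := near_dist_le (0 : C) eK; have := near_dist_le (0 : C) r2.
apply: filterS2 => h; rewrite !sub0r !normrN => hr2 heK.
have zhr : `|z + h| <= r.
  by rewrite (le_trans (ler_normD _ _))// [leRHS]splitr lerD.
apply: le_trans (psum_diff_bound r0 aM' zr zhr _ _ _) _.
- by apply: psum_converges_le M0 rho0 aM _; exact: le_trans r_le.
- by apply: psum_converges_le M0 rho0 aM _; exact: le_trans r_le.
- apply: psum_converges_le (psum_diff_le M0 rho0 aM) _; rewrite ?mulr_gt0//.
  by rewrite mulrA -natrM.
- rewrite expr2 mulrA ler_wpM2r// -ler_pdivlMl//.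
  by rewrite mulrC.
Qed.

End ComplexPowerSeries.

(** * The hypergeometric series and its differential equation *)

Section HypergeometricCoefficients.
Variable K : numFieldType.
Implicit Types a b c z : K.

Definition hyp_coef a b c (n : nat) : K :=
  pochhammer a n * pochhammer b n / (pochhammer c n * n`!%:R).

Lemma hyp_coef0 a b c : hyp_coef a b c 0 = 1.
Proof. by rewrite /hyp_coef /pochhammer !big_ord0 fact0 !mul1r invr1. Qed.

Lemma hyp_coefS a b c n : (forall k, c + k%:R != 0) ->
  n.+1%:R * (c + n%:R) * hyp_coef a b c n.+1 =
  (a + n%:R) * (b + n%:R) * hyp_coef a b c n.
Proof.
move=> c0; have p0 : pochhammer c n != 0 by apply/prodf_neq0.
rewrite /hyp_coef /pochhammer !big_ord_recr/= -!/(pochhammer _ _) factS natrM.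
by field; rewrite p0 c0 nat1r !pnatr_eq0 -lt0n fact_gt0.
Qed.

(** The ratio of consecutive coefficients is (a + n)(b + n) / ((c + n)(n + 1)), at most 1 under
    these bounds. All four parameter triples of the identities satisfy them, so M = rho = 1 serves
    as the geometric bound. *)
Lemma hyp_coef_le1 a b c n : 0 <= a <= c -> 0 <= b <= 1 -> 0 < c ->
  0 <= hyp_coef a b c n <= 1.
Proof.
move=> /andP[a0 ac] /andP[b0 b1] c0.
have cn0 k : 0 < c + k%:R by rewrite ltr_wpDr.
elim: n => [|n /andP[IH0 IH1]]; first by rewrite hyp_coef0 ler01 lexx.
have d0 : 0 < n.+1%:R * (c + n%:R) by rewrite mulr_gt0.
have := hyp_coefS a b n (fun k => lt0r_neq0 (cn0 k)).
move=> /(canRL (mulKf (lt0r_neq0 d0))) ->; apply/andP; split.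
  apply: mulr_ge0; first by rewrite invr_ge0 ltW.
  by apply: mulr_ge0 => //; apply: mulr_ge0; exact: addr_ge0.
rewrite ler_pdivrMl// mulr1.
apply: le_trans (_ : (a + n%:R) * (b + n%:R) <= _).
  by rewrite ler_piMr// mulr_ge0// addr_ge0.
by rewrite mulrC ler_pM ?addr_ge0 ?lerD2r// -natr1 addrC lerD2l.
Qed.

(** The coefficients of z times the series of [u]. *)
Definition psum_shift (u : nat -> K) : nat -> K :=
  fun n => if n is m.+1 then u m else 0.

Lemma cvg_psum_shift (u : nat -> K) z l :
  series (fun n => u n * z ^+ n) @ \oo --> l ->
  series (fun n => psum_shift u n * z ^+ n) @ \oo --> z * l.
Proof.
move=> ul; rewrite -cvg_shiftS.
rewrite (_ : (fun n => _) = fun n => z * series (fun n => u n * z ^+ n) n).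
  exact: cvgMl_tmp.
apply/funext => n; rewrite /series /= big_nat_recl//= mul0r add0r big_distrr/=.
by apply: eq_bigr => i _; rewrite exprS; ring.
Qed.

Lemma psum_hyp_coef_ode a b c z : (forall k, c + k%:R != 0) ->
  let A := hyp_coef a b c in
  let A1 := psum_diff A in let A2 := psum_diff A1 in
  psum_converges A z -> psum_converges A1 z -> psum_converges A2 z ->
  z * (1 - z) * psum A2 z + (c - (a + b + 1) * z) * psum A1 z -
    a * b * psum A z = 0.
Proof.
move=> c0 A A1 A2 cA cA1 cA2.
have {cA} hA : series (fun n => A n * z ^+ n) @ \oo --> psum A z by [].
have {cA1} hA1 : series (fun n => A1 n * z ^+ n) @ \oo --> psum A1 z by [].
have {cA2} hA2 : series (fun n => A2 n * z ^+ n) @ \oo --> psum A2 z by [].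
have hzA1 := cvg_psum_shift hA1; have hzA2 := cvg_psum_shift hA2.
have hzzA2 := cvg_psum_shift hzA2.
apply/eqP; rewrite -normr_le0; apply/eqP.
have -> : z * (1 - z) * psum A2 z + (c - (a + b + 1) * z) * psum A1 z -
    a * b * psum A z = z * psum A2 z - z * (z * psum A2 z) +
    (c * psum A1 z - (a + b + 1) * (z * psum A1 z)) - a * b * psum A z by ring.
apply/eqP.
(* The equation truncated at the same power of z in all five series. By the recurrence each
   coefficient vanishes, so every [E n] is exactly 0, and so is its limit. *)
pose E n := series (fun n => psum_shift A2 n * z ^+ n) n -
  series (fun n => psum_shift (psum_shift A2) n * z ^+ n) n +
  (c * series (fun n => A1 n * z ^+ n) n -
   (a + b + 1) * series (fun n => psum_shift A1 n * z ^+ n) n) -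
  a * b * series (fun n => A n * z ^+ n) n.
apply: (@norm_lim_le _ E) => [|n].
  apply: cvgB; last exact: cvgMl_tmp.
  by apply: cvgD; apply: cvgB => //; exact: cvgMl_tmp.
rewrite normr_le0; apply/eqP; elim: n => [|n IHn].
  by rewrite /E /series /= !big_nil; ring.
suff H : (psum_shift A2 n - psum_shift (psum_shift A2) n +
  (c * A1 n - (a + b + 1) * psum_shift A1 n) - a * b * A n) = 0.
  transitivity (E n + (psum_shift A2 n - psum_shift (psum_shift A2) n +
    (c * A1 n - (a + b + 1) * psum_shift A1 n) - a * b * A n) * z ^+ n).
    by rewrite /E /series /= !big_nat_recr//=; ring.
  by rewrite H IHn mul0r addr0.
have recA := hyp_coefS a b n c0; rewrite -/A in recA.
rewrite /A2 /A1 /psum_shift /psum_diff.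
(* The indices 0 and 1 are separate because [psum_shift], applied once or twice, has its default
   value 0 there. *)
case: n recA {IHn} => [|[|n]] recA.
- transitivity (1%:R * (c + 0%:R) * A 1%N - (a + 0%:R) * (b + 0%:R) * A 0%N).
    by ring.
  by rewrite recA subrr.
- transitivity (2%:R * (c + 1%:R) * A 2%N - (a + 1%:R) * (b + 1%:R) * A 1%N).
    by ring.
  by rewrite recA subrr.
- transitivity (n.+3%:R * (c + n.+2%:R) * A n.+3 -
    (a + n.+2%:R) * (b + n.+2%:R) * A n.+2).
    by rewrite -(natr1 n.+2) -(natr1 n.+1) -(natr1 n); ring.
  by rewrite recA subrr.
Qed.

End HypergeometricCoefficients.

Section HypergeometricSolution.
Variable K : numFieldType.

Lemma hyp_solution_psum (a b c : K) : (forall k, c + k%:R != 0) ->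
  let A := hyp_coef a b c in
  let A1 := psum_diff A in let A2 := psum_diff A1 in
  (\forall z \near (0 : K), psum_converges A z) ->
  (\forall z \near (0 : K), psum_converges A1 z) ->
  (\forall z \near (0 : K), psum_converges A2 z) ->
  (\forall z \near (0 : K), is_derive (z : K) 1 (psum A) (psum A1 z)) ->
  (\forall z \near (0 : K), is_derive (z : K) 1 (psum A1) (psum A2 z)) ->
  hyp_solution a b c (psum A) 0.
Proof.
move=> c0 A A1 A2 cF cF1 cF2 dF dF1; have dF' := near_join dF.
rewrite /hyp_solution /=; near=> z.
have F1z : is_derive (z : K) 1 (psum A) (psum A1 z) by near: z.
have F2z : is_derive (z : K) 1 (derive1 (psum A)) (psum A2 z).
  have near_z : \forall w \near z, is_derive (w : K) 1 (psum A) (psum A1 w).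
    by near: z.
  apply: (@near_eq_is_derive _ _ _ (psum A1)); last by near: z.
  by apply: filterS near_z => w /derive1_is_derive.
split; [by case: F1z | by case: F2z |].
rewrite (derive1_is_derive F2z) (derive1_is_derive F1z).
by apply: psum_hyp_coef_ode => //; near: z.
Unshelve. all: by end_near. Qed.

Lemma hyp2F1_0 (a b c : K) : hyp2F1 a b c 0 = 1.
Proof. by rewrite -[LHS]/(psum (hyp_coef a b c) 0) psum0 hyp_coef0. Qed.

End HypergeometricSolution.

Section HypergeometricFunction.
Variable R : realType.
Local Notation C := (Cplx R).

Lemma hyp2F1_solution (a b c : C) : 0 <= a <= c -> 0 <= b <= 1 -> 0 < c ->
  hyp_solution a b c (hyp2F1 a b c) 0.
Proof.
move=> ac b1 c0.
have cn0 (k : nat) : c + k%:R != 0 by rewrite gt_eqF// ltr_wpDr.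
have gA : geom_bounded (hyp_coef a b c).
  exists 1, 1; split=> // n; rewrite expr1n mulr1.
  by have /andP[A0 A1] := hyp_coef_le1 n ac b1 c0; rewrite ger0_norm.
have gA1 := geom_bounded_psum_diff gA.
have gA2 := geom_bounded_psum_diff gA1.
exact: (hyp_solution_psum cn0 (near_psum_converges gA) (near_psum_converges gA1)
  (near_psum_converges gA2) (is_derive_psum gA) (is_derive_psum gA1)).
Qed.

End HypergeometricFunction.

(** * Differentiation along rays, and a Gronwall inequality *)

Section RadialDerivative.
Variable R : realType.
Local Notation C := (Cplx R).
Implicit Types z w x : C.

(** The norm with values in R; the norm of [Cplx R] takes its values in [Cplx R] itself. *)
Definition modulus z : R := Num.sqrt (complex.Re z ^+ 2 + complex.Im z ^+ 2).

Definition cdot z w : R :=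
  complex.Re z * complex.Re w + complex.Im z * complex.Im w.

Lemma modulusE z : `|z| = (modulus z)%:C.
Proof. exact: CplxnormE. Qed.

Lemma modulus_ge0 z : 0 <= modulus z.
Proof. exact: sqrtr_ge0. Qed.

Lemma modulusM z w : modulus (z * w) = modulus z * modulus w.
Proof. by apply: (@complexI R); rewrite rmorphM /= -!modulusE normrM. Qed.

Lemma modulusD z w : modulus (z + w) <= modulus z + modulus w.
Proof. by rewrite -lecR rmorphD /= -!modulusE ler_normD. Qed.

Lemma modulus1 : modulus 1 = 1.
Proof. by rewrite /modulus /= expr1n expr0n addr0 sqrtr1. Qed.

Lemma modulusN z : modulus (- z) = modulus z.
Proof. by apply: (@complexI R); rewrite -!modulusE normrN. Qed.

Lemma modulusV z : modulus z^-1 = (modulus z)^-1.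
Proof. by apply: (@complexI R); rewrite fmorphV /= -!modulusE normfV. Qed.

Lemma modulus_eq0 z : (modulus z == 0) = (z == 0).
Proof. by rewrite -(inj_eq (@complexI R)) -modulusE normr_eq0. Qed.

Lemma sqr_modulus z : modulus z ^+ 2 = complex.Re z ^+ 2 + complex.Im z ^+ 2.
Proof. by rewrite sqr_sqrtr// addr_ge0 ?sqr_ge0. Qed.

Lemma cdot_le z w : cdot z w <= modulus z * modulus w.
Proof.
apply: le_trans (ler_norm _) _.
rewrite -ler_sqr ?nnegrE ?mulr_ge0 ?modulus_ge0// real_normK ?num_real//.
rewrite exprMn !sqr_modulus -subr_ge0 /cdot.
have -> : forall a b c d : R, (a ^+ 2 + b ^+ 2) * (c ^+ 2 + d ^+ 2) -
  (a * c + b * d) ^+ 2 = (a * d - b * c) ^+ 2 by move=> *; ring.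
exact: sqr_ge0.
Qed.

Lemma continuous_ray x : continuous (fun s : R => s%:C * x : C).
Proof.
apply: continuous_dist_le => s _ /gt0_realP[e e0 ->].
(* Adding 1 keeps the divisor positive when x = 0. *)
have d0 : 0 < modulus x + 1 by rewrite ltr_wpDl ?modulus_ge0.
exists (e / (modulus x + 1)); first by rewrite divr_gt0.
move=> t; rewrite ler_pdivlMr// => st.
rewrite -mulrBl -rmorphB modulusE lecR modulusM.
have -> : modulus (s - t)%:C = `|s - t|.
  by rewrite /modulus /= expr0n addr0 sqrtr_sqr.
by apply: le_trans st; rewrite ler_wpM2l// lerDl.
Qed.

(** [P] stands for [Re] or [Im]; additivity, R-homogeneity and |P z| <= |z| are all that is needed
    to push the complex estimate down to a real one. *)
Let is_derive_radial (P : C -> R) (p : C -> C) x (dp : C) (t : R) :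
  (forall z w, P (z - w) = P z - P w) ->
  (forall z, `|P z| <= modulus z) ->
  (forall (s : R) z, P (s%:C * z) = s * P z) ->
  is_derive (t%:C * x : C) 1 p dp ->
  is_derive (t : R) 1 (fun s => P (p (s%:C * x))) (P (x * dp)).
Proof.
move=> P_add P_le P_lin /is_deriveP Hp; apply/is_deriveP => e e0.
have d0 : 0 < modulus x + 1 by rewrite ltr_wpDl ?modulus_ge0.
have e1 : 0 < (e / (modulus x + 1))%:C :> C by rewrite ltcR divr_gt0.
have cont := @continuous_ray x 0; rewrite /continuous_at mul0r in cont.
have near_s : \forall s \near (0 : R),
    `|p (t%:C * x + s%:C * x) - p (t%:C * x) - s%:C * x * dp| <=
    (e / (modulus x + 1))%:C * `|s%:C * x : C| := cont _ (Hp _ e1).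
apply: filterS near_s => s Hs.
rewrite rmorphD mulrDl -P_lin -!P_add.
apply: le_trans (P_le _) _; rewrite mulrA -lecR -modulusE.
apply: le_trans Hs _; rewrite modulusE -rmorphM lecR modulusM.
have -> : modulus s%:C = `|s| by rewrite /modulus /= expr0n addr0 sqrtr_sqr.
have -> : e / (modulus x + 1) * (`|s| * modulus x) =
    e * `|s| * (modulus x / (modulus x + 1)) by ring.
apply: ler_piMr; first by rewrite mulr_ge0// ltW.
by rewrite ler_pdivrMr// mul1r lerDl.
Qed.

Lemma is_derive_radial_Re (p : C -> C) x (dp : C) (t : R) :
  is_derive (t%:C * x : C) 1 p dp ->
  is_derive (t : R) 1 (fun s => complex.Re (p (s%:C * x))) (complex.Re (x * dp)).
Proof.
apply: is_derive_radial => [[? ?] [? ?]|z|s [? ?]] //=.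
- by rewrite -lecR -modulusE Re_le_norm.
- by rewrite mul0r subr0.
Qed.

Lemma is_derive_radial_Im (p : C -> C) x (dp : C) (t : R) :
  is_derive (t%:C * x : C) 1 p dp ->
  is_derive (t : R) 1 (fun s => complex.Im (p (s%:C * x))) (complex.Im (x * dp)).
Proof.
apply: is_derive_radial => [[? ?] [? ?]|z|s [? ?]] //=.
- by rewrite -lecR -modulusE Im_le_norm.
- by rewrite mul0r addr0.
Qed.

Lemma is_derive_radial_sqr (p : C -> C) x (dp : C) (t : R) :
  is_derive (t%:C * x : C) 1 p dp ->
  is_derive (t : R) 1 (fun s => modulus (p (s%:C * x)) ^+ 2)
    (2 * cdot (p (t%:C * x)) (x * dp)).
Proof.
move=> px; have rp := is_derive_radial_Re px; have ip := is_derive_radial_Im px.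
have -> : (fun s => modulus (p (s%:C * x)) ^+ 2) =
    (fun s => complex.Re (p (s%:C * x)) ^+ 2 + complex.Im (p (s%:C * x)) ^+ 2).
  by apply/funext => s; rewrite sqr_modulus.
apply: is_derive_eq (is_derive1D (is_derive1X 1 rp) (is_derive1X 1 ip)) _.
by rewrite /cdot; ring.
Qed.

End RadialDerivative.

Section Gronwall.
Variable R : realType.

(** F(t) exp(- k t) is nonincreasing on ]0, 1]. Nothing is required of F at the singular end 0;
    arbitrarily small values at points of ]0, 1[ replace an initial condition. *)
Lemma gronwall_eq0 (F dF : R -> R) (k : R) :
  (forall t, 0 < t <= 1 -> is_derive (t : R) 1 F (dF t)) ->
  (forall t, 0 < t <= 1 -> dF t <= k * F t) ->
  (forall t, 0 <= F t) ->
  (forall e, 0 < e -> exists2 t, 0 < t < 1 & F t <= e) ->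
  F 1 = 0.
Proof.
move=> derF dF_le F0 Fsmall.
pose G t := F t * expR (- k * t).
have derG t : 0 < t <= 1 ->
    is_derive (t : R) 1 G ((dF t - k * F t) * expR (- k * t)).
  move=> /derF Ft.
  apply: is_derive_eq (is_derive1M Ft (is_derive_chain
    (is_derive1Z (- k) (is_derive1_id t)) (is_derive_expR _))) _.
  by ring.
have G_le t : 0 < t < 1 -> G 1 <= G t.
  move=> /andP[t0 t1].
  apply: (@ler0_derive1_le_cc _ G t 1) => //.
  - move=> u; rewrite in_itv/= => /andP[tu u1].
    by case: (derG u) => //; rewrite (lt_trans t0 tu) ltW.
  - move=> u; rewrite in_itv/= => /andP[tu u1].
    have u01 : 0 < u <= 1 by rewrite (lt_trans t0 tu) ltW.
    rewrite (derive1_is_derive (derG u u01)) pmulr_lle0 ?expR_gt0//.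
    by rewrite subr_le0 dF_le.
  - apply: derivable_within_continuous => u; rewrite in_itv/= => /andP[tu u1].
    by case: (derG u) => //; rewrite (lt_le_trans t0 tu).
  - by rewrite in_itv/= lexx ltW.
  - by rewrite in_itv/= lexx ltW.
  - exact: ltW.
have k0 : 0 < expR `|k| by exact: expR_gt0.
apply/eqP; rewrite eq_le F0 andbT; apply/ler_addgt0Pl => e e0; rewrite addr0.
(* One factor exp |k| pays for exp(- k t) at the chosen t, the other for removing exp(- k) from F
   1. *)
have e1 : 0 < e / (expR (`|k|) * expR `|k|) by rewrite divr_gt0 ?mulr_gt0.
have [t t01 Ft] := Fsmall _ e1.
have /andP[t0 t1] := t01.
have := G_le t t01; rewrite /G mulr1 => GG.
have expk : expR (- k * t) <= expR `|k|.
  rewrite ler_expR (le_trans (ler_norm _))// normrM normrN.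
  by rewrite ler_piMr// ger0_norm ltW.
have H : F 1 * expR (- k) <= e / (expR `|k| * expR `|k|) * expR `|k|.
  apply: le_trans GG _; apply: ler_pM => //; exact: expR_ge0.
have Hk : expR k <= expR `|k| by rewrite ler_expR ler_norm.
have H2 := ler_pM (mulr_ge0 (F0 1) (expR_ge0 _)) (expR_ge0 k) H Hk.
rewrite -(mulrA (F 1)) -expRD addNr expR0 mulr1 in H2.
apply: le_trans H2 _; rewrite le_eqVlt; apply/orP; left; apply/eqP.
by field; rewrite gt_eqF.
Qed.

End Gronwall.

(** * Uniqueness of the solution with given value at 0 *)

Section HypSolutionLinear.
Variable K : numFieldType.
Implicit Types (a b c : K) (y : K -> K).

Lemma hyp_solutionB a b c y1 y2 z0 :
  hyp_solution a b c y1 z0 -> hyp_solution a b c y2 z0 ->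
  hyp_solution a b c (fun z => y1 z - y2 z) z0.
Proof.
rewrite /hyp_solution /= => H1 H2.
have dE z : derivable y1 z 1 -> derivable y2 z 1 ->
    is_derive z 1 (fun z => y1 z - y2 z) (derive1 y1 z - derive1 y2 z).
  by move=> d1 d2; apply: is_derive1B; exact: is_derive_derive1.
have H : \forall z \near z0, \forall w \near z,
    derive1 (fun z => y1 z - y2 z) w = derive1 y1 w - derive1 y2 w.
  apply: near_join; near=> z.
  have [d1 _ _] : [/\ derivable y1 z 1, derivable (derive1 y1) z 1 &
    z * (1 - z) * derive1 (derive1 y1) z +
      (c - (a + b + 1) * z) * derive1 y1 z - a * b * y1 z = 0] by near: z.
  have [d2 _ _] : [/\ derivable y2 z 1, derivable (derive1 y2) z 1 &
    z * (1 - z) * derive1 (derive1 y2) z +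
      (c - (a + b + 1) * z) * derive1 y2 z - a * b * y2 z = 0] by near: z.
  exact: derive1_is_derive (dE z d1 d2).
near=> z.
have [d1 dd1 e1] : [/\ derivable y1 z 1, derivable (derive1 y1) z 1 &
    z * (1 - z) * derive1 (derive1 y1) z +
      (c - (a + b + 1) * z) * derive1 y1 z - a * b * y1 z = 0] by near: z.
have [d2 dd2 e2] : [/\ derivable y2 z 1, derivable (derive1 y2) z 1 &
    z * (1 - z) * derive1 (derive1 y2) z +
      (c - (a + b + 1) * z) * derive1 y2 z - a * b * y2 z = 0] by near: z.
have nz : \forall w \near z,
    derive1 (fun z => y1 z - y2 z) w = derive1 y1 w - derive1 y2 w by near: z.
have dz := dE z d1 d2.
have ddz : is_derive z 1 (derive1 (fun z => y1 z - y2 z))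
    (derive1 (derive1 y1) z - derive1 (derive1 y2) z).
  apply: (@near_eq_is_derive _ _ _ (fun w => derive1 y1 w - derive1 y2 w)).
    by apply: filterS nz => w ->.
  by apply: is_derive1B; exact: is_derive_derive1.
split; [by case: dz | by case: ddz |].
rewrite (derive1_is_derive ddz) (derive1_is_derive dz).
rewrite -(subrr (0 : K)) -{1}e1 -e2.
move: (derive1 (derive1 y1) z) (derive1 (derive1 y2) z) => u1 u2.
move: (derive1 y1 z) (derive1 y2 z) => v1 v2; ring.
Unshelve. all: by end_near. Qed.

(** At the singular point z = 0 the equation degenerates to c y'(0) = a b y(0). *)
Lemma hyp_solution_deriv0 a b c y : c != 0 -> y 0 = 0 ->
  hyp_solution a b c y 0 -> derive1 y 0 = 0.
Proof.
move=> c0 y0 /nbhs_singleton [_ _]; rewrite y0 !(mul0r, mulr0, subr0, add0r).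
by move/eqP; rewrite mulf_eq0 (negPf c0) => /eqP.
Qed.

Lemma hyp_solution_small a b c y (e : K) : c != 0 -> y 0 = 0 ->
  hyp_solution a b c y 0 -> 0 < e ->
  \forall z \near (0 : K), `|derive1 y z| <= e /\ `|y z| <= e * `|z|.
Proof.
move=> c0 y0 Hy e0; have y'0 := hyp_solution_deriv0 c0 y0 Hy.
have [d1 d2 _] := nbhs_singleton Hy.
have c1 : {for (0 : K), continuous (derive1 y)}.
  exact: is_derive1_continuous (derivableP d2).
have H1 : \forall z \near (0 : K), `|derive1 y 0 - derive1 y z| <= e.
  by move: c1 => /(@cvgrPdist_le _ _ _ (nbhs (0 : K)))/(_ e e0).
have /is_deriveP/(_ e e0) H2 := derivableP d1.
near=> z; split.
  have : `|derive1 y 0 - derive1 y z| <= e by near: z.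
  by rewrite y'0 sub0r normrN.
have : `|y (0 + z) - y 0 - z * 'D_1 y 0| <= e * `|z| by near: z.
by rewrite -derive1E y'0 y0 add0r mulr0 !subr0.
Unshelve. all: by end_near. Qed.

Lemma hyp_solution_ball a b c y : hyp_solution a b c y 0 ->
  exists2 r : K, 0 < r & forall z, `|z| < r ->
  [/\ derivable y z 1, derivable (derive1 y) z 1 &
    z * (1 - z) * derive1 (derive1 y) z +
      (c - (a + b + 1) * z) * derive1 y z - a * b * y z = 0].
Proof.
move=> /nbhs_ballP[r r0 Hr]; exists r => // z zr.
by apply: Hr; rewrite /ball /= sub0r normrN.
Qed.

End HypSolutionLinear.

Section Uniqueness.
Variable R : realType.
Local Notation C := (Cplx R).
Implicit Types (p q w z x : C).

(** The bound 1/4 on c comes from here: - c |p| ^ 2 + p . q - |q| ^ 2 equals - (c - 1/4) |p| ^ 2 -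
    |p / 2 - q| ^ 2, hence is nonpositive. Only the term with z w remains, and Cauchy-Schwarz with P
    (P + Q) <= 2 (P ^ 2 + Q ^ 2) bounds it. *)
Lemma cdot_cancel p q w z (c K : R) : 1 / 4 <= c ->
  modulus w <= K * (modulus p + modulus q) -> 0 <= K ->
  cdot p (- c%:C * p + z * w) + cdot q (p - q) <=
  2 * K * modulus z * (modulus p ^+ 2 + modulus q ^+ 2).
Proof.
move=> c4 wle K0.
have H : cdot p (z * w) <=
    2 * K * modulus z * (modulus p ^+ 2 + modulus q ^+ 2).
  apply: le_trans (cdot_le _ _) _; rewrite modulusM.
  have := modulus_ge0 p; have := modulus_ge0 q; have := modulus_ge0 z.
  have := modulus_ge0 w.
  move: (modulus p) (modulus q) (modulus w) (modulus z) wle => P Q W Z.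
  move=> WK W0 Z0 Q0 P0.
  have H1 : P * W <= P * (K * (P + Q)) by rewrite ler_wpM2l.
  have H2 : P * (P + Q) <= 2 * (P ^+ 2 + Q ^+ 2) by nra.
  have H3 := ler_wpM2l (mulr_ge0 Z0 K0) H2.
  have H4 := ler_wpM2l Z0 H1.
  by lra.
suff H' : cdot p (- c%:C * p + z * w) + cdot q (p - q) <= cdot p (z * w).
  exact: le_trans H.
rewrite -subr_ge0; move: (z * w) => v {H wle}.
case: p q v => [p1 p2] [q1 q2] [v1 v2]; rewrite /cdot /=.
have -> : p1 * v1 + p2 * v2 -
    (p1 * (- c * p1 - - 0 * p2 + v1) + p2 * (- c * p2 + - 0 * p1 + v2) +
     (q1 * (p1 - q1) + q2 * (p2 - q2))) =
    (c - 1 / 4) * (p1 ^+ 2 + p2 ^+ 2) +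
    (p1 / 2 - q1) ^+ 2 + (p2 / 2 - q2) ^+ 2 by field.
by rewrite !addr_ge0 ?sqr_ge0// mulr_ge0 ?subr_ge0// addr_ge0 ?sqr_ge0.
Qed.


(** Separates the singular part - c p of z p' from a remainder z w, where w is linear in p and Y / z
    with coefficients bounded near 0. *)
Lemma hyp_ode_rhs (a b c z Y p pp : C) : z != 0 -> 1 - z != 0 ->
  z * (1 - z) * pp + (c - (a + b + 1) * z) * p - a * b * Y = 0 ->
  z * pp = - c * p + z * ((- (c - a - b - 1) * p + a * b * (Y / z)) / (1 - z)).
Proof.
move=> z0 z1 ode; apply: (mulfI z1).
transitivity (z * (1 - z) * pp + (c - (a + b + 1) * z) * p - a * b * Y +
  (- (c - (a + b + 1) * z) * p + a * b * Y)); first by ring.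
by rewrite ode; field; rewrite z0 z1.
Qed.

Lemma cdotZ z w (t : R) : t * cdot z w = cdot z (t%:C * w).
Proof. by case: z w => [? ?] [? ?]; rewrite /cdot /=; ring. Qed.

Lemma hyp_rhs_le (k l z p q : C) : 1 / 2 <= modulus (1 - z) ->
  modulus ((- k * p + l * q) / (1 - z)) <=
    (2 * modulus k + 2 * modulus l) * (modulus p + modulus q).
Proof.
move=> zh; rewrite modulusM modulusV ler_pdivrMr; last by lra.
apply: le_trans (modulusD _ _) _; rewrite !modulusM modulusN.
have := modulus_ge0 k; have := modulus_ge0 l.
have := modulus_ge0 p; have := modulus_ge0 q.
move: (modulus _) (modulus k) (modulus l) (modulus p) (modulus q) zh.
move=> Z K L P Q Zh Q0 P0 L0 K0.
have H : 0 <= (K + L) * (P + Q) by rewrite mulr_ge0// addr_ge0.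
have H1 := ler_wpM2l H Zh.
have H2 := mulr_ge0 K0 Q0; have H3 := mulr_ge0 L0 P0.
by lra.
Qed.

Lemma ray_small (P : C -> Prop) x : (\forall z \near (0 : C), P z) ->
  exists2 t : R, 0 < t < 1 & P (t%:C * x).
Proof.
move=> P0; have cont := @continuous_ray R x 0.
rewrite /continuous_at mul0r in cont.
have Pt : \forall t \near (0 : R), P (t%:C * x) := cont _ P0.
have /nbhs_ballP[e e0 He] := Pt.
have m0 : 0 < Num.min e 1 by rewrite lt_min e0 ltr01.
have m2 : Num.min e 1 / 2 < Num.min e 1.
  by rewrite ltr_pdivrMr// ltr_pMr// ltr1n.
exists (Num.min e 1 / 2).
  by rewrite divr_gt0//= (lt_le_trans m2)// ge_min lexx orbT.
apply: He; rewrite /ball /= sub0r normrN ger0_norm ?divr_ge0// ?(ltW m0)//.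
by rewrite (lt_le_trans m2)// ge_min lexx.
Qed.

Lemma hyp_solution_eq0 (a b : C) (c : R) (y : C -> C) : 1 / 4 <= c ->
  y 0 = 0 -> hyp_solution a b c%:C y 0 -> \forall z \near (0 : C), y z = 0.
Proof.
move=> c4 y0 Hy.
have cR0 : 0 < c by apply: lt_le_trans c4.
have c0 : c%:C != 0 :> C by rewrite gt_eqF// ltcR.
have [_ /gt0_realP[r r0 ->] Hr] := hyp_solution_ball Hy.
(* The bound 1/2 keeps |1 - z| >= 1/2, as [hyp_rhs_le] requires. *)
pose rho := Num.min r (1 / 2).
have rho0 : 0 < rho by rewrite lt_min r0 divr_gt0.
have rho0C : 0 < (rho / 2)%:C :> C by rewrite ltcR divr_gt0.
have := near_dist_le (0 : C) rho0C; apply: filterS => x.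
rewrite sub0r normrN modulusE lecR => xrho.
have [->//|x0] := eqVneq x 0.
pose q (z : C) : C := y z / z.
pose F t := modulus (derive1 y (t%:C * x)) ^+ 2 + modulus (q (t%:C * x)) ^+ 2.
pose dq z := (derive1 y z * z - y z) / z ^+ 2.
pose dF t := 2 * cdot (derive1 y (t%:C * x)) (x * derive1 (derive1 y) (t%:C * x)) +
  2 * cdot (q (t%:C * x)) (x * dq (t%:C * x)).
pose K := 2 * modulus (c%:C - a - b - 1) + 2 * modulus (a * b).
have K0 : 0 <= K by rewrite addr_ge0// mulr_ge0 ?modulus_ge0.
have ray t : 0 < t <= 1 -> modulus (t%:C * x) < rho.
  move=> /andP[t0 t1]; rewrite modulusM.
  have -> : modulus t%:C = t by rewrite /modulus /= expr0n addr0 sqrtr_sqr gtr0_norm.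
  apply: (@le_lt_trans _ _ (rho / 2)).
    by apply: le_trans xrho; rewrite ler_piMl ?modulus_ge0.
  by rewrite ltr_pdivrMr// ltr_pMr// ltr1n.
have ray0 t : 0 < t -> t%:C * x != 0 by move=> t0; rewrite mulf_neq0// gt_eqF// ltcR.
have Hz t : 0 < t <= 1 -> [/\ derivable y (t%:C * x : C) 1,
    derivable (derive1 y) (t%:C * x : C) 1 &
    t%:C * x * (1 - t%:C * x) * derive1 (derive1 y) (t%:C * x) +
      (c%:C - (a + b + 1) * (t%:C * x)) * derive1 y (t%:C * x) -
      a * b * y (t%:C * x) = 0].
  move=> t01; apply: Hr; rewrite modulusE ltcR (lt_le_trans (ray t t01))//.
  by rewrite ge_min lexx.
suff F1 : F 1 = 0.
  move/eqP: F1; rewrite /F mul1r paddr_eq0 ?sqr_ge0// => /andP[_].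
  rewrite sqrf_eq0 modulus_eq0 /q mulf_eq0 invr_eq0 (negPf x0) orbF.
  by move/eqP.
(* The 4 is 2 from differentiating the squares times the 2 of [cdot_cancel]; [modulus x] is what is
   left of |t x| after division by t. *)
apply: (@gronwall_eq0 R F dF (4 * K * modulus x)).
- move=> t /[dup] t01 /Hz[d1 d2 _]; have /andP[t0 _] := t01.
  have e1 := is_derive_radial_sqr (is_derive_derive1 d2).
  have e2 := is_derive_radial_sqr
    (is_derive_div (g := fun z => z) (ray0 t t0) (is_derive_derive1 d1)
      (is_derive1_id _)).
  apply: is_derive_eq (is_derive1D e1 e2) _.
  by rewrite /dF /dq mulr1.
- move=> t /[dup] t01 /Hz[_ _ ode]; have /andP[t0 _] := t01.
  have z_lt := ray t t01; have z0 := ray0 t t0.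
  (* Multiplication by t turns x p'(t x) into z p'(z) with z = t x, the quantity that the equation
     controls. *)
  rewrite -(ler_pM2l t0) /dF /F.
  set z := t%:C * x in z_lt z0 ode *.
  have z_half : modulus z < 1 / 2 by rewrite (lt_le_trans z_lt)// ge_min lexx orbT.
  have z1_half : 1 / 2 <= modulus (1 - z).
    have := modulusD (1 - z) z; rewrite subrK modulus1; move: z_half; lra.
  have z1 : 1 - z != 0.
    by rewrite -modulus_eq0 gt_eqF// (lt_le_trans _ z1_half)// divr_gt0.
  have zpp := hyp_ode_rhs z0 z1 ode.
  have zdq : z * dq z = derive1 y z - q z by rewrite /dq /q; field.
  set w : C := _ / (1 - z) in zpp.
  have w_le : modulus w <= K * (modulus (derive1 y z) + modulus (q z)).
    exact: hyp_rhs_le.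
  have -> : t * (2 * cdot (derive1 y z) (x * derive1 (derive1 y) z) +
      2 * cdot (q z) (x * dq z)) =
      2 * (cdot (derive1 y z) (z * derive1 (derive1 y) z) + cdot (q z) (z * dq z)).
    by rewrite /z -!mulrA -!cdotZ; ring.
  rewrite zpp zdq.
  have := cdot_cancel z c4 w_le K0.
  rewrite [modulus z]modulusM.
  have -> : modulus t%:C = t.
    by rewrite /modulus /= expr0n addr0 sqrtr_sqr gtr0_norm.
  move: (cdot _ _ + _) (modulus x) (modulus _ ^+ 2 + _) => A X B; lra.
- by move=> t; rewrite addr_ge0 ?sqr_ge0.
- move=> e e0.
  (* As d <= 1, also d ^ 2 <= d <= e / 2: half of e for each of the two squares in F. *)
  pose d := Num.min 1 (e / 2).
  have d0 : 0 < d by rewrite lt_min ltr01 divr_gt0.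
  have d0C : 0 < d%:C :> C by rewrite ltcR.
  have [t t01 []] := ray_small x (hyp_solution_small c0 y0 Hy d0C).
  have /andP[t0 t1] := t01.
  rewrite !modulusE -rmorphM !lecR => H1 H2.
  exists t => //.
  have dd : d ^+ 2 <= e / 2.
    apply: (@le_trans _ _ d); last by rewrite ge_min lexx orbT.
    by rewrite expr2 ler_piMr ?ge_min ?lexx// ltW.
  rewrite [leRHS]splitr lerD// (le_trans _ dd)// lerXn2r ?nnegrE ?modulus_ge0//
    ?(ltW d0)//.
  rewrite /q modulusM modulusV ler_pdivrMr// lt_neqAle modulus_ge0 andbT.
  by rewrite eq_sym modulus_eq0 ray0.
Qed.

Lemma hyp_solution_unique (a b c : C) (y1 y2 : C -> C) : 1 / 4 <= c ->
  y1 0 = y2 0 -> hyp_solution a b c y1 0 -> hyp_solution a b c y2 0 ->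
  \forall z \near (0 : C), y1 z = y2 z.
Proof.
move=> c4 y12 H1 H2.
have y0 : y1 0 - y2 0 = 0 by rewrite y12 subrr.
have := hyp_solutionB H1 H2.
have /gt0_realP[r r0 cE] : 0 < c by apply: lt_le_trans c4; rewrite divr_gt0.
rewrite cE => /hyp_solution_eq0 H.
have {}H := H _ y0; have : \forall z \near (0 : C), y1 z - y2 z = 0.
  apply: H; rewrite -lecR -cE (_ : (1 / 4)%:C = 1 / 4)//.
  by rewrite rmorphM fmorphV rmorph1 rmorph_nat.
by apply: filterS => z /eqP; rewrite subr_eq0 => /eqP.
Qed.

End Uniqueness.

(** * Logarithms and branches of powers *)

Section GeometricSeries.
Variable K : numFieldType.

Lemma psum_1 (z : K) : psum_converges (fun=> 1) z ->
  (1 - z) * psum (fun=> 1) z = 1.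
Proof.
move=> cz.
have {}cz : series (fun n => 1 * z ^+ n) @ \oo --> psum (fun=> 1) z by [].
have sz := cvg_psum_shift cz; rewrite -cvg_shiftS in sz.
rewrite -cvg_shiftS in cz.
apply/eqP; rewrite -subr_eq0 -normr_le0.
have -> : (1 - z) * psum (fun=> 1) z - 1 =
  psum (fun=> 1) z - z * psum (fun=> 1) z - 1 by ring.
pose E n := series (fun n => 1 * z ^+ n) n.+1 -
  series (fun n => psum_shift (fun=> 1) n * z ^+ n) n.+1 - 1.
apply: (@norm_lim_le _ E) => [|n].
  by apply: cvgB; [exact: cvgB|exact: cvg_cst].
rewrite normr_le0 /E /series /= !big_nat_recl//= mul0r add0r.
by rewrite expr0 mulr1 addrK subrr.
Qed.

(** Differentiating E(L) = f gives L' = f' / f for any branch of the logarithm, hence g' / g = e f'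
    / f whichever branch g is. *)
Lemma exp_log_derive (E f df L g : K -> K) (e x0 : K) :
  (forall x : K, is_derive x 1 E (E x)) -> (forall x, E x != 0) ->
  (\forall x \near x0, is_derive (x : K) 1 f (df x)) ->
  (\forall x \near x0, derivable L (x : K) 1 /\ E (L x) = f x) ->
  (\forall x \near x0, g x = E (e * L x)) ->
  \forall x \near x0, is_derive (x : K) 1 g (e * (df x / f x) * g x).
Proof.
move=> dE E0 dF HL Hg; have HL' := near_join HL; have Hg' := near_join Hg.
near=> x.
have dfx : is_derive (x : K) 1 f (df x) by near: x.
have [dLx Lx] : derivable L x 1 /\ E (L x) = f x by near: x.
have gx : g x = E (e * L x) by near: x.
have nL : \forall w \near x, derivable L w 1 /\ E (L w) = f w by near: x.
have ng : \forall w \near x, g w = E (e * L w) by near: x.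
have ELx := is_derive_chain (derivableP dLx) (dE (L x)).
have dfE : df x = E (L x) * 'D_1 L x.
  rewrite -(derive1_is_derive dfx) -(derive1_is_derive ELx) !derive1E.
  by apply: near_eq_derive; apply: filterS nL => w [_ ->].
apply: (@near_eq_is_derive _ _ _ (fun w => E (e * L w))).
  by apply: filterS ng => w ->.
apply: is_derive_eq (is_derive_chain (is_derive1Z e (derivableP dLx)) (dE _)) _.
by rewrite gx dfE -Lx; field; exact: E0.
Unshelve. all: by end_near. Qed.

Lemma log_comp (E L u : K -> K) : u 0 = 0 ->
  (\forall x \near (0 : K), derivable u (x : K) 1) ->
  (\forall x \near (0 : K), derivable L (x : K) 1 /\ E (L x) = 1 - x) ->
  \forall x \near (0 : K),
    derivable (fun x => L (u x)) (x : K) 1 /\ E (L (u x)) = 1 - u x.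
Proof.
move=> u0 du HL.
have uc : {for (0 : K), continuous u}.
  exact: is_derive1_continuous (derivableP (nbhs_singleton du)).
rewrite -[X in \forall x \near X, derivable L x _ /\ _]u0 in HL.
have cu : \forall x \near (0 : K),
  derivable L (u x : K) 1 /\ E (L (u x)) = 1 - u x := uc _ HL.
near=> x.
have dux : derivable u (x : K) 1 by near: x.
have [dlog Ex] : derivable L (u x : K) 1 /\ E (L (u x)) = 1 - u x by near: x.
split; last exact: Ex.
by case: (is_derive_chain (derivableP dux) (derivableP dlog)).
Unshelve. all: by end_near. Qed.

End GeometricSeries.

Section LogarithmBranches.
Variable R : realType.
Local Notation C := (Cplx R).
Implicit Types (z x : C).

(** On each segment from 0 the real function |G - G 0| ^ 2 has derivative 0, so it keeps its initial
    value 0. *)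
Lemma eq_near0_of_deriv0 (G : C -> C) :
  (\forall z \near (0 : C), is_derive (z : C) 1 G 0) ->
  \forall z \near (0 : C), G z = G 0.
Proof.
move=> /nbhs_ballP[_ /gt0_realP[r r0 ->] Hr].
have r2 : 0 < (r / 2)%:C :> C by rewrite ltcR divr_gt0.
have := near_dist_le (0 : C) r2; apply: filterS => x.
rewrite sub0r normrN modulusE lecR => xr.
pose H z := G z - G 0.
pose F t := modulus (H (t%:C * x)) ^+ 2.
have der t : 0 <= t <= 1 -> is_derive (t : R) 1 F 0.
  move=> /andP[t0 t1].
  have dG : is_derive (t%:C * x : C) 1 G 0.
    apply: Hr; rewrite /ball /= sub0r normrN modulusE ltcR modulusM.
    have -> : modulus t%:C = t.
      by rewrite /modulus /= expr0n addr0 sqrtr_sqr ger0_norm.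
    apply: (@le_lt_trans _ _ (r / 2)).
      by apply: le_trans xr; rewrite ler_piMl ?modulus_ge0.
    by rewrite ltr_pdivrMr// ltr_pMr// ltr1n.
  have dH := is_derive1B dG (is_derive1_cst (G 0) (t%:C * x)).
  apply: is_derive_eq (is_derive_radial_sqr dH) _.
  by rewrite subrr mulr0 /cdot /= !mulr0 addr0 mulr0.
have F10 : F 1 <= F 0.
  apply: (@ler0_derive1_le_cc _ F 0 1) => //.
  - move=> u; rewrite in_itv/= => /andP[u0 u1].
    by case: (der u) => //; rewrite !ltW.
  - move=> u; rewrite in_itv/= => /andP[u0 u1].
    by rewrite (derive1_is_derive (der u _))// !ltW.
  - apply: derivable_within_continuous => u; rewrite in_itv/= => u01.
    by case: (der u u01).
  - by rewrite in_itv/= lexx ler01.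
  - by rewrite in_itv/= lexx ler01.
have F0 : F 0 = 0.
  by rewrite /F mul0r /H subrr /modulus /= expr0n addr0 sqrtr0 expr0n.
have : F 1 == 0 by rewrite eq_le -{1}F0 F10 sqr_ge0.
by rewrite /F mul1r sqrf_eq0 modulus_eq0 /H subr_eq0 => /eqP.
Qed.

(* The Taylor coefficients of - log (1 - z). *)
Definition log_coef (n : nat) : C := if n is m.+1 then m.+1%:R^-1 else 0.

Lemma geom_bounded_log_coef : geom_bounded log_coef.
Proof.
exists 1, 1; split=> // -[|n]; rewrite expr1n mulr1 ?normr0//=.
by rewrite normfV normr_nat invf_le1 ?ler1n// ltr0n.
Qed.

Lemma psum_diff_log_coef : psum_diff log_coef = fun=> 1.
Proof. by apply/funext => n; rewrite /psum_diff /= mulfV ?pnatr_eq0. Qed.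

Definition log1B z : C := - psum log_coef z.

Lemma log1B0 : log1B 0 = 0.
Proof. by rewrite /log1B psum0 oppr0. Qed.

(** The product of exp(sum z ^ n / n) and 1 - z has derivative 0, since the geometric series times 1
    - z is 1, and it equals 1 at 0. *)
Lemma cexp_log1B :
  \forall z \near (0 : C), derivable log1B (z : C) 1 /\ cexp (log1B z) = 1 - z.
Proof.
have gl := geom_bounded_log_coef.
have dl := is_derive_psum gl.
have cl := near_psum_converges (geom_bounded_psum_diff gl).
rewrite psum_diff_log_coef in dl cl.
pose G z := cexp (psum log_coef z) * (1 - z).
have dG : \forall z \near (0 : C), is_derive (z : C) 1 G 0.
  apply: filterS2 dl cl => z dz cz.
  apply: is_derive_eq (is_derive1M
    (is_derive_chain dz (is_derive_cexp (psum log_coef z)))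
    (is_derive1B (is_derive1_cst 1 z) (is_derive1_id z))) _.
  have := psum_1 cz; move: (cexp _) (psum (fun=> 1) z) => u v uv.
  transitivity (u * ((1 - z) * v - 1)); first by ring.
  by rewrite uv subrr mulr0.
have GE := eq_near0_of_deriv0 dG.
apply: filterS2 dl GE => z dz; rewrite /G psum0 cexp0 subr0 mul1r => Gz.
split.
  rewrite (_ : log1B = fun z => 0 - psum log_coef z); last first.
    by apply/funext => w; rewrite sub0r.
  by case: (is_derive1B (is_derive1_cst 0 z) dz).
have := cexpD (psum log_coef z) (log1B z); rewrite subrr cexp0 => H.
by apply: (mulfI (cexp_neq0 (psum log_coef z))); rewrite Gz -H.
Qed.

Lemma pow_branch_1B (u : C -> C) (e : C) : u 0 = 0 ->
  (\forall x \near (0 : C), derivable u (x : C) 1) ->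
  pow_branch (fun x => 1 - u x) e (fun x => cexp (e * log1B (u x))) 0.
Proof.
move=> u0 du.
exists (fun x => log1B (u x)); last by apply: filterS du.
exact: log_comp u0 du cexp_log1B.
Qed.

Lemma pow_branch_derive (f df g : C -> C) (e x0 : C) :
  (\forall x \near x0, is_derive (x : C) 1 f (df x)) ->
  pow_branch f e g x0 ->
  \forall x \near x0, is_derive (x : C) 1 g (e * (df x / f x) * g x).
Proof.
move=> dF [L HL Hg].
exact: (exp_log_derive (@is_derive_cexp R) (@cexp_neq0 R) dF HL Hg).
Qed.

End LogarithmBranches.

(** * Fibres of a rational function on the projective line *)

Section Covering.
Variable K : numFieldType.
Hypothesis closedK : forall f : {poly K},
  exists r : seq K, f = lead_coef f *: \prod_(z <- r) ('X - z%:P).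
Implicit Types (f g p q : {poly K}) (a c : K).

Lemma mupZ a c f : c != 0 -> mup a (c *: f) = mup a f.
Proof. by move=> c0; rewrite -mul_polyC mupMr// rootC. Qed.

Lemma mup_comp_XaddC f a : f != 0 -> mup 0 (f \Po ('X + a%:P)) = mup a f.
Proof.
move=> f0.
have fa0 : f \Po ('X + a%:P) != 0.
  by apply: contra_neq f0 => f0; rewrite -(comp_polyXaddC_K f a) f0 comp_poly0.
apply/eqP; rewrite eqn_leq; apply/andP; split.
  rewrite mup_geq// -[X in _ %| X](comp_polyXaddC_K f a).
  have H : ('X - 0%:P) ^+ mup 0 (f \Po ('X + a%:P)) %| f \Po ('X + a%:P).
    by rewrite -mup_geq.
  have := dvdp_comp_poly ('X - a%:P) H.
  by rewrite rmorphXn /= subr0 comp_polyX.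
rewrite mup_geq//.
have H : ('X - a%:P) ^+ mup a f %| f by rewrite -mup_geq.
have := dvdp_comp_poly ('X + a%:P) H.
by rewrite rmorphXn /= comp_polyB comp_polyX comp_polyC addrK subr0.
Qed.

Lemma sum_count_undup (T : eqType) (r : seq T) :
  (\sum_(a <- undup r) count_mem a r)%N = size r.
Proof.
rewrite -sum1_size -[RHS]big_undup_iterop_count/=.
by apply: eq_bigr => a _; rewrite Monoid.iteropE iter_addn_0 mul1n.
Qed.

Lemma sum_mup_undup f r c : c != 0 -> f = c *: \prod_(z <- r) ('X - z%:P) ->
  (\sum_(a <- undup r) mup a f)%N = (size f).-1.
Proof.
move=> c0 ->; rewrite size_scale// size_prod_XsubC /= -[RHS]sum_count_undup.
by apply: eq_bigr => a _; rewrite mupZ// mu_prod_XsubC.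
Qed.

Lemma mup_reversal q d : q != 0 -> (size q <= d.+1)%N ->
  mup 0 (\poly_(i < d.+1) q`_(d - i)) = (d.+1 - size q)%N.
Proof.
move=> q0 qd.
have sq : (0 < size q)%N by rewrite size_poly_gt0.
(* The reversal at length [size q]: its constant term is the leading coefficient of q, so every zero
   at 0 comes from the padding up to d. *)
pose g := \poly_(i < size q) q`_((size q).-1 - i).
have -> : \poly_(i < d.+1) q`_(d - i) = 'X^(d.+1 - size q) * g.
  apply/polyP => i; rewrite coefXnM !coef_poly.
  case: ltnP => di; last first.
    by rewrite !ifN// -leqNgt; move: (size q) qd sq di => s; clear; lia.
  case: ltnP => im; first rewrite nth_default//.
    by move: (size q) qd sq di im => s; clear; lia.
  rewrite ifT; first congr (q`_ _).
    by move: (size q) qd sq di im => s; clear; lia.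
  by move: (size q) qd sq di im => s; clear; lia.
rewrite mupMl.
  by rewrite -['X]subr0 -polyC0 mup_XsubCX eqxx.
by rewrite rootE horner_coef0 coef_poly sq subn0 -lead_coefE lead_coef_eq0.
Qed.

Section Degrees.
Variables p q : {poly K}.
Hypotheses (q0 : q != 0) (pq : (size q < size p)%N) (copq : coprimep p q).

Let d := (size p).-1.
Let sp : size p = d.+1. Proof. by rewrite /d prednK// (leq_ltn_trans _ pq). Qed.

Let ratdegE : ratdeg p q = d.
Proof. by rewrite /ratdeg (maxn_idPl (ltnW pq)). Qed.

Let local0 (f : {poly K}) a : (local_form d f (Some a)).[0] = f.[a].
Proof. by rewrite /= horner_comp !hornerE. Qed.

Let localoo (f : {poly K}) : (local_form d f None).[0] = f`_d.
Proof. by rewrite /= horner_coef0 coef_poly subn0. Qed.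

Let P1map_Some a :
  P1map p q (Some a) = if q.[a] == 0 then None else Some (p.[a] / q.[a]).
Proof. by rewrite /P1map ratdegE !local0. Qed.

Let qd0 : q`_d = 0. Proof. by rewrite nth_default// -ltnS -sp. Qed.

Let P1map_None : P1map p q None = None.
Proof. by rewrite /P1map ratdegE !localoo qd0 eqxx. Qed.

Let ram_None : ramification p q None = (size p - size q)%N.
Proof.
rewrite /ramification ratdegE !localoo qd0 scale0r sub0r -scaleNr mupZ.
  by rewrite mup_reversal// ?sp// ltnW// -sp.
by rewrite oppr_eq0 /d -lead_coefE lead_coef_eq0 -size_poly_gt0 sp.
Qed.

Let pole_num a : q.[a] = 0 -> p.[a] != 0.
Proof.
move=> qa; apply: (coprimep_root (_ : coprimep q p)).
  by rewrite coprimep_sym.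
exact/eqP.
Qed.

Let ram_pole a : q.[a] = 0 -> ramification p q (Some a) = mup a q.
Proof.
move=> qa; rewrite /ramification ratdegE !local0 qa scale0r sub0r -scaleNr.
by rewrite mupZ ?mup_comp_XaddC// oppr_eq0 pole_num.
Qed.

Let ram_finite w a : q.[a] != 0 -> p.[a] = w * q.[a] -> p - w *: q != 0 ->
  ramification p q (Some a) = mup a (p - w *: q).
Proof.
move=> qa pa f0; rewrite /ramification ratdegE !local0 pa.
rewrite mulrC -scalerA -scalerBr mupZ//.
by rewrite -(mup_comp_XaddC a f0) comp_polyB comp_polyZ.
Qed.

(** Over a finite w the fibre consists of the roots of p - w q, which has the degree of p. Over
    infinity the roots of q account for deg q, and the point at infinity for deg p - deg q. *)
Lemma covering_of_size_lt : covering_of_degree p q (size p).-1.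
Proof.
split=> // -[w|].
  have sf : size (p - w *: q) = size p.
    rewrite size_polyDl// size_polyN.
    exact: leq_ltn_trans (size_scale_leq _ _) pq.
  have f0 : p - w *: q != 0 by rewrite -size_poly_gt0 sf sp.
  have [r fr] := closedK (p - w *: q).
  have lf0 : lead_coef (p - w *: q) != 0 by rewrite lead_coef_eq0.
  have mem_r a : (a \in r) = (p.[a] == w * q.[a]).
    rewrite -root_prod_XsubC -(rootZ _ _ lf0) -fr rootE !hornerE subr_eq0.
    by [].
  have rq a : a \in r -> q.[a] != 0.
    rewrite mem_r => /eqP pa; apply: contra_eqN pa => /eqP qa.
    by rewrite qa mulr0 pole_num.
  exists (map Some (undup r)); split.
  - by rewrite map_inj_uniq ?undup_uniq// => ? ? [].
  - case=> [a|].
      rewrite mem_map ?mem_undup; last by move=> ? ? [].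
      rewrite P1map_Some; case: ifPn => qa.
        by apply/negbTE/negP => /rq; rewrite qa.
      rewrite mem_r; apply/eqP/eqP => [->|[<-]]; first by rewrite mulfK.
      by rewrite divfK.
    by rewrite P1map_None; apply/negbTE/mapP => -[].
  - rewrite big_map -sf -(sum_mup_undup lf0 fr) big_seq [RHS]big_seq.
    apply: eq_bigr => a; rewrite mem_undup => /[dup] /rq qa.
    by rewrite mem_r => /eqP pa; exact: ram_finite.
have [r qr] := closedK q.
have lq0 : lead_coef q != 0 by rewrite lead_coef_eq0.
have mem_r a : (a \in r) = (q.[a] == 0).
  by rewrite -root_prod_XsubC -(rootZ _ _ lq0) -qr rootE.
exists (None :: map Some (undup r)); split.
- rewrite /= map_inj_uniq ?undup_uniq ?andbT; last by move=> ? ? [].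
  by apply/mapP => -[].
- case=> [a|]; last by rewrite P1map_None eqxx mem_head.
  rewrite inE /= mem_map ?mem_undup; last by move=> ? ? [].
  by rewrite P1map_Some mem_r; case: ifPn.
- rewrite big_cons big_map ram_None.
  have -> : (\sum_(a <- undup r) ramification p q (Some a))%N = (size q).-1.
    rewrite -(sum_mup_undup lq0 qr) big_seq [RHS]big_seq.
    by apply: eq_bigr => a; rewrite mem_undup mem_r => /eqP; exact: ram_pole.
  by have := pq; have : (0 < size q)%N; [rewrite size_poly_gt0|lia].
Qed.

End Degrees.
End Covering.

Section Phi1Covering.
Variables (C : numFieldType) (omega : C).
Hypothesis omegaP : omega ^+ 2 + omega + 1 = 0.

Let omega2 : omega ^+ 2 = - omega - 1.
Proof. by rewrite -[LHS]subr0 -omegaP; ring. Qed.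

Lemma phi1_slope_neq0 : 6 * omega + 3 != 0.
Proof.
have : (6 * omega + 3) ^+ 2 = - 27 by ring: omega2.
by move=> /eqP; apply: contraTneq => ->; rewrite expr0n eq_sym oppr_eq0 pnatr_eq0.
Qed.

(** The zero (8 + 3 omega) / (6 omega + 3) of L, made explicit by (6 omega + 3) ^ 2 = - 27. *)
Let r : C := - (2 + 13 * omega) / 9.

Let phi1_denE :
  phi1_den omega = (64 * (6 * omega + 3) ^+ 7) *: ('X - r%:P) ^+ 7.
Proof.
rewrite /phi1_den.
have -> : (6 * omega + 3) *: 'X + (- 8 - 3 * omega)%:P =
    (6 * omega + 3) *: ('X - r%:P).
  rewrite scalerBr -(mul_polyC _ r%:P) -polyCM -polyCN; congr (_ + _%:P).
  by rewrite /r; field: omega2.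
by rewrite exprZn scalerA.
Qed.

Let k0 : 64 * (6 * omega + 3) ^+ 7 != 0.
Proof. by rewrite mulf_neq0 ?pnatr_eq0// expf_neq0// phi1_slope_neq0. Qed.

Lemma size_phi1_den : size (phi1_den omega) = 8.
Proof. by rewrite phi1_denE size_scale// size_exp_XsubC. Qed.

Lemma size_phi1_num : size (phi1_num omega) = 9.
Proof.
rewrite /phi1_num; set q := _ - _ + _.
have sq : size q = 3.
  rewrite /q -addrA size_polyDl size_scale ?pnatr_eq0// size_polyXn//.
  rewrite -scaleNr (leq_ltn_trans (size_polyD _ _))// gtn_max.
  rewrite (leq_ltn_trans (size_scale_leq _ _)) ?size_polyX//=.
  by rewrite (leq_ltn_trans (size_polyC_leq1 _)).
have q0 : q != 0 by rewrite -size_poly_gt0 sq.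
have X1 : 'X - 1 != 0 :> {poly C} by rewrite -polyC1 polyXsubC_eq0.
have sX1 : size ('X - 1 : {poly C}) = 2 by rewrite -polyC1 size_XsubC.
have sq3 : size (q ^+ 3) = 7.
  by rewrite -[LHS]prednK ?size_exp ?sq// size_poly_gt0 expf_neq0.
rewrite size_mul ?expf_neq0 ?mulf_neq0 ?polyX_eq0//.
by rewrite size_mul ?polyX_eq0// size_polyX sX1 sq3.
Qed.

(** The denominator has the single root [r], so it suffices that the numerator does not vanish
    there; its quadratic factor takes the value - 7 ^ 4. *)
Lemma coprimep_phi1 : coprimep (phi1_num omega) (phi1_den omega).
Proof.
rewrite phi1_denE coprimepZr// coprimep_expr// coprimep_XsubC rootE.
have r1 : r * (r - 1) = - 147 / 81.
  by rewrite /r; field: omega2.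
have Qr : 27 * r ^+ 2 - (723 + 1392 * omega) * r + (- 496 + 696 * omega) =
    - 2401.
  by rewrite /r; field: omega2.
have -> : (phi1_num omega).[r] = - 147 / 81 * (- 2401) ^+ 3.
  by rewrite -r1 -Qr /phi1_num !hornerE /=; ring.
by rewrite !mulf_neq0 ?expf_neq0 ?invr_neq0 ?oppr_eq0 ?pnatr_eq0.
Qed.

End Phi1Covering.

Lemma covering_phi1 (R : realType) (omega : Cplx R) :
  omega ^+ 2 + omega + 1 = 0 ->
  covering_of_degree (phi1_num omega) (phi1_den omega) 8.
Proof.
move=> omegaP.
(* [Cplx R] exposes only a [numFieldType]; the factorization is imported from the closed field
   structure of [R[i]]. *)
have closedC (f : {poly Cplx R}) :
    exists r : seq (Cplx R), f = lead_coef f *: \prod_(z <- r) ('X - z%:P).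
  by have [r fr] := @closed_field_poly_normal (R[i]) f; exists r.
have := @covering_of_size_lt _ closedC (phi1_num omega) (phi1_den omega).
rewrite size_phi1_num size_phi1_den//; apply=> //.
  by rewrite -size_poly_gt0 size_phi1_den.
exact: coprimep_phi1.
Qed.

(** * Assembly: matching the stated prefactors and parameters *)

Section LogarithmicDerivatives.
Variable K : numFieldType.
Implicit Types (f g tau : K -> K).

Lemma near_all (P : K -> Prop) (x0 : K) :
  (forall x, P x) -> \forall x \near x0, P x.
Proof.
by move=> HP; near=> x; exact: HP.
Unshelve. all: by end_near. Qed.

Lemma near_log_derive_eq f g tau tau' (x0 : K) :
  (\forall x \near x0, f x = g x) -> (forall x, tau x = tau' x) ->
  (\forall x \near x0, is_derive (x : K) 1 g (tau x * g x)) ->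
  \forall x \near x0, is_derive (x : K) 1 f (tau' x * f x).
Proof.
move=> fg tauE dg; have fg' := near_join fg; near=> x.
have nfg : \forall w \near x, f w = g w by near: x.
rewrite -tauE (nbhs_singleton nfg).
apply: (@near_eq_is_derive _ _ _ g); last by near: x.
by apply: filterS nfg => w ->.
Unshelve. all: by end_near. Qed.

Lemma near_log_deriveM g1 g2 tau1 tau2 tau (x0 : K) :
  (forall x, tau1 x + tau2 x = tau x) ->
  (\forall x \near x0, is_derive (x : K) 1 g1 (tau1 x * g1 x)) ->
  (\forall x \near x0, is_derive (x : K) 1 g2 (tau2 x * g2 x)) ->
  \forall x \near x0,
    is_derive (x : K) 1 (fun z => g1 z * g2 z) (tau x * (g1 x * g2 x)).
Proof.
move=> tauE; apply: filterS2 => x d1 d2.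
by apply: is_derive_eq (is_derive1M d1 d2) _; rewrite -tauE; ring.
Qed.

End LogarithmicDerivatives.

Section Phi1Arithmetic.
Variables (K : numFieldType) (omega : K).
Hypothesis omegaP : omega ^+ 2 + omega + 1 = 0.

Let omega2 : omega ^+ 2 = - omega - 1.
Proof. by rewrite -[LHS]subr0 -omegaP; ring. Qed.

Lemma exponent_differences_2_3_7 :
  exponent_differences (1 / 84 : K) (13 / 84) (2 / 3) [:: 1 / 2; 1 / 3; 1 / 7].
Proof.
exists [:: 1 / 3; 1 / 2; 1 / 7].
  by rewrite (perm_catCA [:: 1 / 3] [:: 1 / 2] [:: 1 / 7]).
have -> : 1 - 2 / 3 = 1 / 3 :> K by field.
have -> : 2 / 3 - 1 / 84 - 13 / 84 = 1 / 2 :> K by field.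
have -> : 1 / 84 - 13 / 84 = - (1 / 7) :> K by field.
by rewrite /= !eqxx orbT.
Qed.

Lemma exponent_differences_3_3_7 :
  exponent_differences (2 / 21 : K) (5 / 21) (2 / 3) [:: 1 / 3; 1 / 3; 1 / 7].
Proof.
exists [:: 1 / 3; 1 / 3; 1 / 7] => //.
have -> : 1 - 2 / 3 = 1 / 3 :> K by field.
have -> : 2 / 3 - 2 / 21 - 5 / 21 = 1 / 3 :> K by field.
have -> : 2 / 21 - 5 / 21 = - (1 / 7) :> K by field.
by rewrite /= !eqxx orbT.
Qed.

Lemma frac_le (m n p q : nat) : (m * q.+1 <= p * n.+1)%N ->
  m%:R / n.+1%:R <= p%:R / q.+1%:R :> K.
Proof.
move=> mp; rewrite ler_pdivrMr// mulrAC ler_pdivlMr//.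
by rewrite -!natrM ler_nat.
Qed.

Lemma frac_ge0 (m n : nat) : 0 <= m%:R / n.+1%:R :> K.
Proof. exact: divr_ge0. Qed.

Lemma frac_le1 (m n : nat) : (m <= n.+1)%N -> m%:R / n.+1%:R <= 1 :> K.
Proof. by move=> mn; rewrite ler_pdivrMr// mul1r ler_nat. Qed.

Lemma phi1_const_neq0 : - 8 - 3 * omega != 0.
Proof.
(* The second factor is the conjugate, with [omega] replaced by - 1 - omega. This norm is the 49 in
   the prefactor of the first identity. *)
have : (- 8 - 3 * omega) * (- 5 + 3 * omega) = 49 by ring: omega2.
by move=> /eqP; apply: contraTneq => ->; rewrite mul0r eq_sym pnatr_eq0.
Qed.

Lemma phi1_linE x :
  phi1_lin omega x = (- 8 - 3 * omega) * (1 - (33 + 39 * omega) / 49 * x).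
Proof. by rewrite /phi1_lin; field: omega2. Qed.

(** The prefactor is L normalized to the value 1 at 0; the constant - 8 - 3 omega drops out of the
    logarithmic derivative. The same holds for the constant 27 in [phi1_rtauE]. *)
Lemma phi1_tauE x :
  - (1 / 12) * ((0 - (33 + 39 * omega) / 49) /
    (1 - (33 + 39 * omega) / 49 * x)) = phi1_tau omega x.
Proof.
rewrite /phi1_tau phi1_linE.
have -> : 6 * omega + 3 =
    (- 8 - 3 * omega) * (0 - (33 + 39 * omega) / 49) by field: omega2.
by rewrite [in RHS]invfM mulrACA mulfV ?mul1r// phi1_const_neq0.
Qed.

Lemma phi1_rquadE x : phi1_rquad omega x = 27 *
  (1 - ((241 + 464 * omega) / 9 * x + 8 * (62 - 87 * omega) / 27 * x ^+ 2)).
Proof. by rewrite /phi1_rquad; field. Qed.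

Lemma phi1_rtauE x :
  - (1 / 84) * ((0 - 1) / (1 - x)) +
  - (1 / 28) * ((0 - ((241 + 464 * omega) / 9 +
      8 * (62 - 87 * omega) / 27 * (2 * x))) /
    (1 - ((241 + 464 * omega) / 9 * x + 8 * (62 - 87 * omega) / 27 * x ^+ 2))) =
  phi1_rtau omega x.
Proof.
rewrite /phi1_rtau phi1_rquadE [(27 * _)^-1]invfM.
move: (1 - x)^-1 (1 - (_ + _))^-1 => v w.
by field.
Qed.

Lemma phi1_den_horner x : (phi1_den omega).[x] = 64 * phi1_lin omega x ^+ 7.
Proof. by rewrite /phi1_den /phi1_lin !hornerE /=; ring. Qed.

Definition phi1_linp : {poly K} := (6 * omega + 3) *: 'X + (- 8 - 3 * omega)%:P.

Lemma phi1_linp_neq0 : phi1_linp != 0.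
Proof.
apply: contraNneq (phi1_slope_neq0 omegaP) => /(congr1 (fun f : {poly K} => f`_1)).
by rewrite /phi1_linp coefD coefZ coefX coefC mulr1 addr0 coef0 => ->.
Qed.

Lemma ratfun_phi1_linp : ratfun phi1_linp 1 = phi1_lin omega.
Proof.
apply/funext => x; rewrite /ratfun /phi1_linp /phi1_lin !hornerE divr1.
by ring.
Qed.

End Phi1Arithmetic.

Section Phi1Theorem.
Variables (R : realType) (omega : Cplx R).
Local Notation C := (Cplx R).
Hypothesis omegaP : omega ^+ 2 + omega + 1 = 0.

Lemma phi1_defines_pullback :
  defines_pullback (phi1_num omega) (phi1_den omega)
    (1 / 84) (13 / 84) (2 / 3) (2 / 21) (5 / 21) (2 / 3).
Proof.
(* Theta is the single factor (L / 1) ^ (-1/12). *)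
exists 1%N, (fun=> phi1_linp omega), (fun=> 1), (fun=> - (1 / 12)); split.
  by move=> _; rewrite oner_eq0 phi1_linp_neq0.
move=> x0 y theta _ _ qx0 _ _ Hy [g Hg Htheta].
have Lx0 : phi1_lin omega x0 != 0.
  by move: qx0; rewrite phi1_den_horner mulf_eq0 negb_or expf_eq0 => /andP[_].
apply: (hyp_solution_phi1 omegaP Lx0 _ Hy).
have Hg0 := Hg ord0; rewrite ratfun_phi1_linp in Hg0.
have dL : \forall x \near x0,
    is_derive (x : C) 1 (phi1_lin omega) (6 * omega + 3).
  exact: near_all (is_derive_phi1_lin omega).
have dg := pow_branch_derive dL Hg0.
apply: near_log_derive_eq dg; last by [].
by apply: filterS Htheta => x ->; rewrite big_ord1.
Qed.

Lemma phi1_identity : exists g : C -> C,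
  [/\ pow_branch (fun x => 1 - (33 + 39 * omega) / 49 * x) (- (1 / 12)) g 0,
      g 0 = 1 &
      \forall x \near (0 : C), hyp2F1 (2 / 21) (5 / 21) (2 / 3) x =
        g x * hyp2F1 (1 / 84) (13 / 84) (2 / 3) (phi1 omega x)].
Proof.
pose u (x : C) := (33 + 39 * omega) / 49 * x.
have u0 : u 0 = 0 by rewrite /u mulr0.
have du x : is_derive (x : C) 1 u ((33 + 39 * omega) / 49).
  by apply: is_derive_eq (is_derive1Z _ (is_derive1_id x)) _; rewrite mulr1.
have ndu : \forall x \near (0 : C), derivable u (x : C) 1.
  by apply: near_all => x; case: (du x).
have Hg := pow_branch_1B (- (1 / 12)) u0 ndu.
set g := fun x => cexp _ in Hg.
have g0 : g 0 = 1 by rewrite /g u0 log1B0 mulr0 cexp0.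
exists g; split=> //.
have df : \forall x \near (0 : C),
    is_derive (x : C) 1 (fun x => 1 - u x) (0 - (33 + 39 * omega) / 49).
  by apply: near_all => x; exact: is_derive1B (is_derive1_cst 1 x) (du x).
have dg := pow_branch_derive df Hg.
have Lx0 : phi1_lin omega 0 != 0.
  by rewrite (phi1_linE omegaP) mulr0 subr0 mulr1 phi1_const_neq0.
have phi0 : phi1 omega 0 = 0 by rewrite phi1E !mul0r.
have {}dg : \forall x \near (0 : C),
    is_derive (x : C) 1 g (phi1_tau omega x * g x).
  by apply: near_log_derive_eq (phi1_tauE omegaP) dg; exact: near_all.
have Hy : hyp_solution (1 / 84) (13 / 84) (2 / 3)
    (hyp2F1 (1 / 84) (13 / 84) (2 / 3)) (phi1 omega 0).
  rewrite phi0; apply: hyp2F1_solution.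
  - by rewrite (frac_ge0 C 1 83) (frac_le C (m:=1) (n:=83) (p:=2) (q:=2)).
  - by rewrite (frac_ge0 C 13 83) (frac_le1 C (m:=13) (n:=83)).
  - by rewrite divr_gt0.
apply: (hyp_solution_unique _ _ _ (hyp_solution_phi1 omegaP Lx0 dg Hy)).
- exact: (frac_le C (m:=1) (n:=3) (p:=2) (q:=2)).
- by rewrite phi0 !hyp2F1_0 g0 mulr1.
- apply: hyp2F1_solution.
  - by rewrite (frac_ge0 C 2 20) (frac_le C (m:=2) (n:=20) (p:=2) (q:=2)).
  - by rewrite (frac_ge0 C 5 20) (frac_le1 C (m:=5) (n:=20)).
  - by rewrite divr_gt0.
Qed.

Lemma phi1_identity_infinity : exists g h : C -> C,
  [/\ pow_branch (fun x => 1 - x) (- (1 / 84)) g 0 /\ g 0 = 1,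
      pow_branch (fun x => 1 - (241 + 464 * omega) / 9 * x
          - 8 * (62 - 87 * omega) / 27 * x ^+ 2) (- (1 / 28)) h 0 /\
        h 0 = 1 &
      \forall x \near (0 : C),
        hyp2F1 (2 / 21) (3 / 7) (6 / 7) x =
        g x * h x *
        hyp2F1 (1 / 84) (29 / 84) (6 / 7) (1 / phi1 omega (1 / x))].
Proof.
pose u (x : C) := (241 + 464 * omega) / 9 * x +
  8 * (62 - 87 * omega) / 27 * x ^+ 2.
have -> : (fun x : C => 1 - (241 + 464 * omega) / 9 * x -
    8 * (62 - 87 * omega) / 27 * x ^+ 2) = (fun x => 1 - u x).
  by apply/funext => x; rewrite /u opprD addrA.
have u0 : u 0 = 0 by rewrite /u expr0n !mulr0 addr0.
pose du (x : C) := (241 + 464 * omega) / 9 +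
  8 * (62 - 87 * omega) / 27 * (2 * x).
have uP x : is_derive (x : C) 1 u (du x).
  apply: is_derive_eq (is_derive1D (is_derive1Z _ (is_derive1_id x))
    (is_derive1Z _ (is_derive1X 1 (is_derive1_id x)))) _.
  by rewrite /du !mulr1 expr1.
have Hg : pow_branch (fun x : C => 1 - x) (- (1 / 84))
    (fun x => cexp (- (1 / 84) * log1B x)) 0.
  by apply: (pow_branch_1B (u := fun x => x)) => //;
    apply: near_all => x; case: (is_derive1_id x).
have Hh : pow_branch (fun x : C => 1 - u x) (- (1 / 28))
    (fun x => cexp (- (1 / 28) * log1B (u x))) 0.
  by apply: pow_branch_1B => //; apply: near_all => x; case: (uP x).
set g := fun x => cexp _ in Hg; set h := fun x => cexp _ in Hh.
have g0 : g 0 = 1 by rewrite /g log1B0 mulr0 cexp0.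
have h0 : h 0 = 1 by rewrite /h u0 log1B0 mulr0 cexp0.
exists g, h; split=> //.
have dG : \forall x \near (0 : C), is_derive (x : C) 1 (fun x => 1 - x) (0 - 1).
  by apply: near_all => x; exact: is_derive1B (is_derive1_cst 1 x) (is_derive1_id x).
have dH : \forall x \near (0 : C),
    is_derive (x : C) 1 (fun x => 1 - u x) (0 - du x).
  by apply: near_all => x; exact: is_derive1B (is_derive1_cst 1 x) (uP x).
have dgh := near_log_deriveM (phi1_rtauE omega)
  (pow_branch_derive dG Hg) (pow_branch_derive dH Hh).
have one0 : 1 - 0 != 0 :> C by rewrite subr0 oner_eq0.
have Q0 : phi1_rquad omega 0 != 0.
  by rewrite phi1_rquadE -/(u 0) u0 subr0 mulr1 pnatr_eq0.
have phi0 : phi1_inv omega 0 = 0 by rewrite /phi1_inv mulr0 !mul0r.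
have Hy : hyp_solution (1 / 84) (29 / 84) (6 / 7)
    (hyp2F1 (1 / 84) (29 / 84) (6 / 7)) (phi1_inv omega 0).
  rewrite phi0; apply: hyp2F1_solution.
  - by rewrite (frac_ge0 C 1 83) (frac_le C (m:=1) (n:=83) (p:=6) (q:=6)).
  - by rewrite (frac_ge0 C 29 83) (frac_le1 C (m:=29) (n:=83)).
  - by rewrite divr_gt0.
(* [phi1_invE] also holds at x = 0, so [phi1_inv] may replace 1 / phi1 (1 / x) on the whole
   neighbourhood. *)
suff H : \forall x \near (0 : C), hyp2F1 (2 / 21) (3 / 7) (6 / 7) x =
    g x * h x * hyp2F1 (1 / 84) (29 / 84) (6 / 7) (phi1_inv omega x).
  by apply: filterS H => x; rewrite phi1_invE.
apply: (hyp_solution_unique _ _ _ (hyp_solution_phi1_inv omegaP one0 Q0 dgh Hy)).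
- exact: (frac_le C (m:=1) (n:=3) (p:=6) (q:=6)).
- by rewrite phi0 !hyp2F1_0 g0 h0 !mulr1.
- apply: hyp2F1_solution.
  - by rewrite (frac_ge0 C 2 20) (frac_le C (m:=2) (n:=20) (p:=6) (q:=6)).
  - by rewrite (frac_ge0 C 3 6) (frac_le1 C (m:=3) (n:=6)).
  - by rewrite divr_gt0.
Qed.

End Phi1Theorem.

Theorem mainTheorem2 (R : realType) (omega : Cplx R)
    (omegaP : omega ^+ 2 + omega + 1 = 0) :
  [/\ covering_of_degree (phi1_num omega) (phi1_den omega) 8,
      (exists a b c a' b' c' : Cplx R,
        [/\ exponent_differences a b c [:: 1 / 2; 1 / 3; 1 / 7],
            exponent_differences a' b' c' [:: 1 / 3; 1 / 3; 1 / 7] &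
            defines_pullback (phi1_num omega) (phi1_den omega)
              a b c a' b' c']),
      (exists g : Cplx R -> Cplx R,
        [/\ pow_branch (fun x => 1 - (33 + 39 * omega) / 49 * x)
              (- (1 / 12)) g 0,
            g 0 = 1 &
            \forall x \near (0 : Cplx R),
              hyp2F1 (2 / 21) (5 / 21) (2 / 3) x =
              g x * hyp2F1 (1 / 84) (13 / 84) (2 / 3) (phi1 omega x)]) &
      (exists g h : Cplx R -> Cplx R,
        [/\ pow_branch (fun x => 1 - x) (- (1 / 84)) g 0 /\ g 0 = 1,
            pow_branch (fun x => 1 - (241 + 464 * omega) / 9 * x
                - 8 * (62 - 87 * omega) / 27 * x ^+ 2) (- (1 / 28)) h 0 /\
              h 0 = 1 &
            \forall x \near (0 : Cplx R),
              hyp2F1 (2 / 21) (3 / 7) (6 / 7) x =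
              g x * h x *
              hyp2F1 (1 / 84) (29 / 84) (6 / 7) (1 / phi1 omega (1 / x))])].
Proof.
split.
- exact: covering_phi1.
- exists (1 / 84), (13 / 84), (2 / 3), (2 / 21), (5 / 21), (2 / 3); split.
  + exact: exponent_differences_2_3_7.
  + exact: exponent_differences_3_3_7.
  + exact: phi1_defines_pullback.
- exact: phi1_identity.
- exact: phi1_identity_infinity.
Qed.
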